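(* Let $\alpha:[0,\infty)\to[0,\infty)$ be an increasing convex function with $\alpha(0)=0$, and let $\alpha^*(t):=\sup_{s\ge0}\{st-\alpha(s)\}$ for $t\ge0$. Assume that there is $b_0\in(0,\infty]$ with $\{t\in[0,\infty):\alpha^*(t)<\infty\}=[0,b_0)$, and that there exist $t_0>0$ and $c_0>0$ such that $\alpha^*(t)\ge c_0t^2$ for $t\in[0,t_0]$. Then there is a constant $m_\alpha$, depending only on the function $\alpha$ (i.e., on the constants $c_0,t_0$), such that the following holds. Let $(E,d)$ be a Polish space and let $\{\mu_\theta\}_{\theta\in\Theta}$ be a family of Borel probability measures on $E$ which satisfy the inequality $\mathbf{T}_{1,\alpha}$. Take any $x_0\in E$, denote $$B_\theta(x_0):=\int_Ed(x,x_0)\,d\mu_\theta(x),\qquad\theta\in\Theta,$$ and suppose that there exist $\lambda>0$ and $\delta\in(0,1/(\lambda+1))$ such that $$I_\Theta(x_0,\delta,\lambda):=\int_\Theta\exp\bigl(\delta\lambda\,\alpha(B_\theta(x_0)/\lambda)\bigr)\,dm(\theta)<\infty .$$ Then the mixture $\mu_{\mathrm{mix}}$ of the family with respect to the mixing probability measure $m$ on $\Theta$ satisfies the $\mathbf{T}_{1,\alpha(\cdot/a)}$ inequality with $$a=\frac{2\sqrt2\,m_\alpha}{\delta}\Bigl(1+\frac1{\log2}\log\Bigl(\frac{1+\delta}{1-\delta}\,I_\Theta(x_0,\delta,\lambda)\Bigr)\Bigr).$$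
   Context: Mixture: $(\Theta,\mathfrak{M},m)$ is a probability space, for every Borel set $A\subset E$ the map $\theta\mapsto\mu_\theta(A)$ is measurable, and $\mu_{\mathrm{mix}}(A):=\int_\Theta\mu_\theta(A)\,dm(\theta)$ for Borel $A\subset E$. Relative entropy: $H(\nu|\mu):=\int_E\log\bigl(\frac{d\nu}{d\mu}\bigr)d\nu$ if $\nu\ll\mu$ and $+\infty$ otherwise. Transport cost: $\mathcal{T}_d(\mu,\nu):=\inf_\pi\int_{E\times E}d(x,y)\,d\pi(x,y)$, the infimum over all couplings $\pi$ of $\mu$ and $\nu$. For an increasing function $\alpha:[0,\infty)\to[0,\infty)$ with $\alpha(0)=0$, a Borel probability measure $\mu$ on $E$ satisfies $\mathbf{T}_{1,\alpha}$ if $\alpha\bigl(\mathcal{T}_d(\mu,\nu)\bigr)\le H(\nu|\mu)$ for all Borel probability measures $\nu$ on $E$. $\alpha(\cdot/a)$ denotes the function $t\mapsto\alpha(t/a)$.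
   Formalization: The constant m_α is proved to depend only on the function α, not only on the constants c_0, t_0 as the parenthesis says; that stronger dependence is false (Dirac measures mixed by an exponential law, with α* infinite beyond 2ε). *)

(* Defs.v *)
From HB Require Import structures.
From mathcomp Require Import all_boot all_order all_algebra.
From mathcomp Require Import all_classical all_reals all_analysis.
From mathcomp Require Import measurable_realfun.

Set Implicit Arguments.
Unset Strict Implicit.
Unset Printing Implicit Defensive.

Import Order.TTheory GRing.Theory Num.Theory.
Import numFieldNormedType.Exports.

Local Open Scope classical_set_scope.
Local Open Scope ring_scope.

#[short(type="completeMetricType")]
HB.structure Definition CompleteMetric (K : numDomainType) :=
  {M of CompletePseudoMetric K M & Metric K M}.

Definition separable (T : topologicalType) : Prop :=
  exists2 D : set T, countable D & dense D.

Notation borel E := (g_sigma_algebraType (@open E)).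

Section transport_entropy.
Context {R : realType}.
Local Open Scope ereal_scope.

(* Only the values of alpha on [0, +oo[ matter: the supremum runs over
   s >= 0, and alpha^* is used at t >= 0. *)
Definition conjugate (alpha : R -> R) (t : R) : \bar R :=
  ereal_sup [set (s * t - alpha s)%:E | s in `[0%R, +oo[%classic].

(* A nondecreasing alpha on [0, +oo[ is extended to [0, +oo] by its limit at
   +oo, since transport costs and first moments may be infinite; the value at
   -oo is never used. *)
Definition extend (alpha : R -> R) (x : \bar R) : \bar R :=
  match x with
  | r%:E => (alpha r)%:E
  | +oo => ereal_sup [set (alpha s)%:E | s in `[0%R, +oo[%classic]
  | -oo => 0
  end.

Definition relative_entropy d (T : measurableType d) (nu mu : probability T R)
    : \bar R :=
  if `[< nu `<< mu >] then
    \int[nu]_x lne (Radon_Nikodym (charge_of_finite_measure nu) mu x)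
  else +oo.

Section cost.
Variable E : completeMetricType R.
Implicit Types mu nu : probability (borel E) R.

(* For separable E, the product sigma-algebra on borel E * borel E is the
   Borel sigma-algebra of the product space. *)
Definition coupling mu nu : set (probability (borel E * borel E)%type R) :=
  [set pi | (forall A, measurable A -> pi (fst @^-1` A) = mu A) /\
            (forall A, measurable A -> pi (snd @^-1` A) = nu A)].

Definition transport_cost mu nu : \bar R :=
  ereal_inf [set \int[pi]_z (mdist (z.1 : E) (z.2 : E))%:E
            | pi in coupling mu nu].

Definition T1 (alpha : R -> R) mu : Prop :=
  forall nu, extend alpha (transport_cost mu nu) <= relative_entropy nu mu.

Definition first_moment (x0 : E) mu : \bar R :=
  \int[mu]_x (mdist (x : E) x0)%:E.

End cost.

Section mixture.
Context d d' (Theta : measurableType d) (T : measurableType d').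

Definition measurable_family (mu : Theta -> probability T R) : Prop :=
  forall A, measurable A ->
    measurable_fun [set: Theta] (fun theta => mu theta A).

Variables (m : probability Theta R) (mu : Theta -> probability T R).

(* The measurability proof makes the set function a probability measure. *)
Definition mixture of measurable_family mu : set T -> \bar R :=
  fun A => \int[m]_theta mu theta A.

Hypothesis mmu : measurable_family mu.

Let mixture0 : mixture mmu set0 = 0.
Proof.
by rewrite /mixture (eq_integral (cst 0)) ?integral0// => y _; rewrite measure0.
Qed.

Let mixture_ge0 A : 0 <= mixture mmu A.
Proof. by apply: integral_ge0 => theta _; exact: measure_ge0. Qed.

Let mixture_sigma_additive : semi_sigma_additive (mixture mmu).
Proof.
move=> F mF tF mUF; rewrite [X in _ --> X](_ : _ =
    \int[m]_theta (\sum_(n <oo) mu theta (F n))); last first.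
  by apply: eq_integral => theta _; rewrite measure_semi_bigcup.
rewrite integral_nneseries//; last by move=> n; exact: mmu.
exact: is_cvg_nneseries.
Qed.

HB.instance Definition _ := isMeasure.Build _ T R (mixture mmu)
  mixture0 mixture_ge0 mixture_sigma_additive.

Let mixture_setT : mixture mmu setT = 1.
Proof.
rewrite /mixture (eq_integral (cst 1)); last first.
  by move=> theta _; exact: probability_setT.
by rewrite integral_cst// mul1e; exact: probability_setT.
Qed.

HB.instance Definition _ := Measure_isProbability.Build _ T R (mixture mmu)
  mixture_setT.

End mixture.

End transport_entropy.

(* Main.v *)
Require Import Defs.
From HB Require Import structures.
From mathcomp Require Import all_boot all_order all_algebra.
From mathcomp Require Import all_classical all_reals all_analysis.
From mathcomp Require Import measurable_realfun.
From mathcomp Require Import giry ring lra.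
Import Order.TTheory GRing.Theory Num.Theory.
Import numFieldNormedType.Exports.
Local Open Scope classical_set_scope.
Local Open Scope ring_scope.

Set Implicit Arguments.
Unset Strict Implicit.
Unset Printing Implicit Defensive.

(** Write [d] for the distance, [B] for the mean of [d(., x0)] under a member
    of the family, [X] for the positive part of [d(., x0) - B], and
    [Q = (1 + delta) / (1 - delta) * I]. An exponential moment of [d(., x0)]
    is extracted from the transport inequality of each member, it is averaged
    over the mixing measure, and the moment of the mixture is turned back into
    a transport inequality.

    From transport to moments. This is Marton's argument. Conditioning [mu] on
    a set [S] costs the relative entropy [- ln (mu S)]. As [d(., x0)] is
    1-Lipschitz, the transport cost to the conditioned measure is at least the
    gain in the mean of [d(., x0)]. If [X >= t] on [S], that gain is at least
    [t], so [alpha t <= - ln (mu S)] ([transport_tail]). Summing over the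
    integer levels of [alpha X] bounds the integral of [exp (delta * alpha X)]
    by [L / (1 - delta)] with [L = 1 + 2 e] ([transport_exp_moment]). Since
    [d(., x0) <= B + X] and [delta * (lambda + 1) <= 1], convexity gives
    [alpha (delta * d) <= delta * lambda * alpha (B / lambda) + delta * alpha X].
    Hence the integral of [exp (alpha (delta * d))] under the mixture is at
    most [L * Q]. Dividing the distance by some [p >= log2 (L * Q)] lowers this
    moment to 2 ([exp_moment_rescale]), because
    [alpha (t / p) <= alpha t / p].

    From moments to transport. Let [F] be the density of [nu] with respect to
    [mu]. Leaving the common part of [mu] and [nu] in place, and moving the
    excess of [mu] independently onto the excess of [nu], shows that the
    transport cost is at most the integral of [d(x, x0) * |F x - 1|]
    ([transport_cost_le_weighted_variation]). The relative entropy is the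
    integral of [relent F], where [relent x = x ln x - x + 1], whose convex
    conjugate is [exp - 1]. Young's inequality for this pair bounds the weighted
    variation in two ways. A quadratic version controls small costs, because
    near 0 [alpha] is at most a multiple of the square: this is what the lower
    bound on the conjugate means. A version built on a supporting line of
    [alpha] controls large costs. Together they give
    [alpha (J / C) <= H] for the variation [J] of the rescaled distance and the
    entropy [H] ([rate_inequality]), where [C] depends on [alpha] alone.

    Since [p] can be taken to be [(1 + log2 L) * (1 + log2 Q)], the factor [L]
    is absorbed in [m_alpha = C * (1 + log2 L)]. *)

(** * Convex rate functions *)

Section convex_rate.
Context {R : realType} (alpha : R -> R).
Hypotheses (alpha0 : alpha 0 = 0)
  (alpha_ge0 : forall t : R, 0 <= t -> 0 <= alpha t)
  (alpha_incr : forall s t : R, 0 <= s -> s <= t -> alpha s <= alpha t)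
  (alpha_convex : @convex_function R R^o `[0, +oo[%classic alpha).

Lemma convex_rateP (p s t : R) : 0 <= p <= 1 -> 0 <= s -> 0 <= t ->
  alpha (p * s + (1 - p) * t) <= p * alpha s + (1 - p) * alpha t.
Proof.
move=> p01 s0 t0.
have := @alpha_convex (Itv01 (andP p01).1 (andP p01).2) s t.
rewrite !convRE/=; apply; rewrite inE/= in_itv/= andbT//.
Qed.

Lemma convex_rate_scale (c s : R) : 0 <= c <= 1 -> 0 <= s ->
  alpha (c * s) <= c * alpha s.
Proof.
by move=> c01 s0; have := convex_rateP c01 s0 (lexx 0); rewrite alpha0 !mulr0 !addr0.
Qed.

Lemma convex_rate_comb (p q s t : R) : 0 <= p -> 0 <= q -> p + q <= 1 ->
  0 <= s -> 0 <= t -> alpha (p * s + q * t) <= p * alpha s + q * alpha t.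
Proof.
move=> p0 q0 pq s0 t0.
have [p1|p1] := eqVneq p 1.
  have -> : q = 0 by lra.
  by rewrite p1 !mul0r !mul1r !addr0.
have p1' : 0 < 1 - p by lra.
have -> : p * s + q * t = p * s + (1 - p) * ((q / (1 - p)) * t).
  by field; apply/eqP; lra.
have q1 : 0 <= q / (1 - p) <= 1.
  by rewrite divr_ge0 ?(ltW p1')//= ler_pdivrMr// mul1r; lra.
have p01 : 0 <= p <= 1 by lra.
have qt0 : 0 <= q / (1 - p) * t by rewrite mulr_ge0//; case/andP: q1.
apply: le_trans (convex_rateP p01 s0 qt0) _.
have := convex_rate_scale q1 t0.
rewrite -(ler_pM2l p1') => /le_trans h; rewrite lerD2l; apply: h.
by rewrite mulrA mulrCA divff ?mulr1// gt_eqF.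
Qed.

(** A supporting line at an interior point. By convexity every slope to the left
    of [s] is at most every slope to the right of [s], so the supremum of the
    left slopes separates them. It is nonnegative because the slope from 0 is. *)
Lemma convex_rate_subgradient (s : R) : 0 < s ->
  exists2 t : R, 0 <= t & forall u, 0 <= u -> alpha s + t * (u - s) <= alpha u.
Proof.
move=> s0.
pose S := [set (alpha s - alpha u) / (s - u) | u in `[0, s[%classic].
have S0 : S !=set0 by exists ((alpha s - alpha 0) / (s - 0)); exists 0 => //=; rewrite in_itv/= lexx s0.
have slope u v : 0 <= u -> u < s -> s < v ->
    (alpha s - alpha u) / (s - u) <= (alpha v - alpha s) / (v - s).
  move=> u0 us sv.
  have su0 : 0 < s - u by lra.
  have vs0 : 0 < v - s by lra.
  have vu0 : 0 < v - u by lra.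
  have p01 : 0 <= (v - s) / (v - u) <= 1.
    by rewrite divr_ge0 ?(ltW vs0) ?(ltW vu0)//= ler_pdivrMr// mul1r; lra.
  have := @convex_rateP _ u v p01 u0 (ltW (le_lt_trans u0 (lt_trans us sv))).
  have -> : (v - s) / (v - u) * u + (1 - (v - s) / (v - u)) * v = s.
    by field; apply/eqP; lra.
  have -> : (v - s) / (v - u) * alpha u + (1 - (v - s) / (v - u)) * alpha v
          = ((v - s) * alpha u + (s - u) * alpha v) / (v - u).
    by field; apply/eqP; lra.
  rewrite ler_pdivlMr// => h.
  rewrite ler_pdivrMr// mulrAC ler_pdivlMr//; nra.
have uS : ubound S ((alpha (s + 1) - alpha s) / (s + 1 - s)).
  by move=> w [u]; rewrite /= in_itv/= => /andP[u0 us] <-; apply: slope => //; lra.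
exists (sup S).
  have h : S ((alpha s - alpha 0) / (s - 0)).
    by exists 0 => //=; rewrite in_itv/= lexx s0.
  apply: le_trans (ub_le_sup _ h); last by exists ((alpha (s + 1) - alpha s) / (s + 1 - s)).
  by rewrite alpha0 !subr0 divr_ge0 ?alpha_ge0// ltW.
move=> u u0.
have [us|su|->] := ltgtP u s; last by rewrite subrr mulr0 addr0.
- have h : S ((alpha s - alpha u) / (s - u)).
    by exists u => //=; rewrite in_itv/= u0 us.
  have : (alpha s - alpha u) / (s - u) <= sup S.
    by apply: (ub_le_sup _ h); exists ((alpha (s + 1) - alpha s) / (s + 1 - s)).
  rewrite ler_pdivrMr ?subr_gt0//; nra.
- have : sup S <= (alpha u - alpha s) / (u - s).
    apply: ge_sup => // w [v]; rewrite /= in_itv/= => /andP[v0 vs] <-.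
    exact: slope.
  rewrite ler_pdivlMr ?subr_gt0//; nra.
Qed.

(** Finiteness of the conjugate at one positive slope [k] says precisely that
    [alpha] grows at least linearly, the intercept being the conjugate at [k]. *)
Lemma conjugate_finite_linear (b0 : \bar R) : (0 < b0)%E ->
  [set t : R | 0 <= t /\ (conjugate alpha t < +oo)%E] =
     [set t : R | 0 <= t /\ (t%:E < b0)%E] ->
  exists k A : R, [/\ 0 < k, 0 <= A & forall s, 0 <= s -> k * s <= alpha s + A].
Proof.
move=> b00 bE.
have [k k0 kb] : exists2 k : R, 0 < k & (k%:E < b0)%E.
  case: b0 b00 {bE} => [b| |]// b00; last by exists 1; rewrite ?ltry.
  move: b00; rewrite lte_fin => b00.
  by exists (b / 2); rewrite ?lte_fin; lra.
have [] : [set t : R | 0 <= t /\ (conjugate alpha t < +oo)%E] k.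
  by rewrite bE/= (ltW k0).
move=> _ kfin.
have h s : 0 <= s -> ((s * k - alpha s)%:E <= conjugate alpha k)%E.
  move=> s0; apply: ereal_sup_ubound; exists s => //=.
  by rewrite in_itv/= s0.
move: kfin h; case: (conjugate alpha k) => [A| |]// _ h.
  exists k, `|A|; split => // s /h; rewrite lee_fin.
  have := ler_norm A; lra.
by have := h 0 (lexx 0).
Qed.

(** A lower bound on the conjugate at [t] produces some [u] with
    [alpha u < u * t - c0 * t ^+ 2 / 2], which forces both [alpha u <= u * t]
    and [c0 * t / 2 <= u]. For [t = 2 * s / c0] the second bound reads
    [s <= u], and convexity between 0 and [u] brings the first one down to [s]. *)
Lemma conjugate_quadratic_upper (t0 c0 : R) : 0 < t0 -> 0 < c0 ->
  (forall t : R, 0 <= t <= t0 -> ((c0 * t ^+ 2)%:E <= conjugate alpha t)%E) ->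
  forall s, 0 <= s <= c0 * t0 / 2 -> alpha s <= 2 / c0 * s ^+ 2.
Proof.
move=> t00 c00 hq s /andP[s0 ss].
move: s0; rewrite le_eqVlt => /predU1P[<-|s0].
  by rewrite alpha0 expr0n/= mulr0.
pose t := 2 * s / c0.
have t_gt0 : 0 < t by rewrite divr_gt0// mulr_gt0.
have tE : c0 * t = 2 * s by rewrite /t; field; apply/eqP; lra.
have tt0 : t <= t0 by rewrite -(ler_pM2l c00) tE; lra.
have h1 : 0 <= t <= t0 by rewrite ltW.
have h2 : ((c0 * t ^+ 2 / 2)%:E < conjugate alpha t)%E.
  apply: lt_le_trans (hq _ h1); rewrite lte_fin.
  have : 0 < c0 * t ^+ 2 by rewrite mulr_gt0// exprn_gt0.
  lra.
have [w [u /=]] := ereal_sup_gt h2.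
rewrite in_itv/= andbT => u0 <-; rewrite lte_fin => h3.
have au := alpha_ge0 u0.
have su : s <= u.
  rewrite -(ler_pM2r t_gt0); have : c0 * t ^+ 2 / 2 = s * t.
    by rewrite expr2 mulrA tE; field.
  lra.
have u_gt0 : 0 < u by lra.
have aut : alpha u <= u * t.
  have : 0 < c0 * t ^+ 2 / 2 by rewrite divr_gt0// mulr_gt0// exprn_gt0.
  lra.
have c1 : 0 <= s / u <= 1 by rewrite divr_ge0 ?(ltW s0)//= ler_pdivrMr// mul1r.
have := convex_rate_scale c1 u0.
rewrite divfK ?gt_eqF// => /le_trans; apply.
have -> : 2 / c0 * s ^+ 2 = s / u * (u * t).
  by rewrite /t; field; apply/andP; split; apply/eqP; lra.
by rewrite ler_wpM2l// divr_ge0// ltW.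
Qed.

(** A substitute for solving [alpha t = x]: the supremum of the points where
    [alpha] is at most [x]. Linear growth makes it finite. It satisfies
    [x <= alpha t] because a convex function cannot jump up immediately to the
    right of a point. *)
Lemma convex_rate_level (k A x : R) : 0 < k ->
  (forall s, 0 <= s -> k * s <= alpha s + A) -> 0 <= x ->
  exists t : R, [/\ 0 <= t, x <= alpha t & forall u, x < alpha u -> 0 <= u -> t <= u].
Proof.
move=> k0 lin x0.
pose S := [set u : R | 0 <= u /\ alpha u <= x].
have S0 : S 0 by split; rewrite ?alpha0.
have uS : ubound S ((x + A) / k).
  move=> u [u0 ux]; rewrite ler_pdivlMr// mulrC; have := lin _ u0; lra.
have supS : has_sup S by split; [exists 0|exists ((x + A) / k)].
have t0 : 0 <= sup S by apply: ub_le_sup => //; case: supS.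
exists (sup S); split => //; last first.
  move=> u xu u0; apply: ge_sup; first by exists 0.
  move=> v [v0 vx]; rewrite leNgt; apply/negP => uv.
  by have := alpha_incr u0 (ltW uv); lra.
rewrite leNgt; apply/negP => ax.
set t := sup S in t0 ax.
pose D := alpha (t + 1) - alpha t.
have D0 : 0 <= D by rewrite subr_ge0 alpha_incr//; lra.
(* With this step, convexity between [t] and [t + 1] keeps [alpha (t + e)] at most [x]. *)
pose e := (x - alpha t) / (D + (x - alpha t)).
have e01 : 0 < e <= 1.
  by rewrite divr_gt0//= ?ler_pdivrMr ?mul1r; lra.
have eD : e * D <= x - alpha t.
  rewrite /e mulrAC ler_pdivrMr; last by lra.
  by rewrite ler_wpM2l; lra.
have : S (t + e).
  split; first by lra.
  have h : 0 <= 1 - e <= 1 by lra.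
  have := convex_rateP h t0 (ltac:(lra) : 0 <= t + 1).
  have -> : (1 - e) * t + (1 - (1 - e)) * (t + 1) = t + e by ring.
  by move=> /le_trans; apply; move: eD; rewrite /D; lra.
move=> /(ub_le_sup supS.2); rewrite -/t; lra.
Qed.

End convex_rate.

(** * Young inequalities for the relative entropy *)

Section entropy_function.
Context {R : realType}.

(** The integrand of relative entropy, normalised so that it is nonnegative and
    vanishes at 1. At 0 the convention [ln 0 = 0] gives the limit value 1. *)
Definition relent (x : R) : R := x * ln x - x + 1.

(** The Fenchel-Young inequality for [relent] and its conjugate [expR - 1]: it is
    [1 + z <= expR z] at [z = g - ln x], multiplied by [x]. *)
Lemma young_relent (x g : R) : 0 <= x -> g * x <= relent x - 1 + expR g.
Proof.
rewrite /relent le_eqVlt => /predU1P[<-|x0].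
  by rewrite mulr0 mul0r !(subr0, add0r) subrr add0r expR_ge0.
have := expR_ge1Dx (g - ln x).
rewrite expRB lnK ?posrE// ler_pdivlMr//; lra.
Qed.

Lemma relent_ge0 (x : R) : 0 <= x -> 0 <= relent x.
Proof. by move=> /(young_relent 0); rewrite mul0r expR0 subrK. Qed.

Lemma expR_quadratic (z : R) : 0 <= z -> expR z - 1 - z <= z ^+ 2 * expR z.
Proof.
move=> z0; have h1 : expR z - 1 <= z * expR z.
  by have := expR_ge1Dx (- z); rewrite expRN -div1r ler_pdivlMr ?expR_gt0//; lra.
have : z * (expR z - 1) <= z * (z * expR z) by rewrite ler_wpM2l.
rewrite expr2 -mulrA; lra.
Qed.

Lemma expRN_quadratic (z : R) : 0 <= z -> expR (- z) - 1 + z <= z ^+ 2.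
Proof.
move=> z0; have z1 : 0 < 1 + z by lra.
have h : expR (- z) <= (1 + z)^-1.
  by rewrite expRN lef_pV2 ?posrE ?expR_gt0// expR_ge1Dx.
have : (1 + z)^-1 - 1 + z <= z ^+ 2.
  have -> : (1 + z)^-1 - 1 + z = z ^+ 2 / (1 + z) by field; apply/eqP; lra.
  by rewrite ler_pdivrMr// ler_peMr ?sqr_ge0//; lra.
lra.
Qed.

(** The weighted form of Pinsker's inequality, with the factor [r] left free.
    Young's inequality at [g = r * y] or [g = - (r * y)], according to the sign
    of [x - 1], leaves the remainder [expR g - 1 - g], which is quadratic in
    [r]. Optimising over [r] after integration gives a square root of the
    entropy. *)
Lemma young_relent_quadratic (x y r : R) : 0 <= x -> 0 <= y -> 0 <= r <= 1 ->
  r * (y * `|x - 1|) <= relent x + r ^+ 2 * (4 * expR (2 * y)).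
Proof.
move=> x0 y0 /andP[r0 r1].
have ry0 : 0 <= r * y by rewrite mulr_ge0.
have ry : r * y <= y by rewrite ler_piMl.
have sq : y ^+ 2 * expR y <= 4 * expR (2 * y).
  have h : y / 2 <= expR (y / 2) by have := expR_ge1Dx (y / 2); lra.
  have : (y / 2) ^+ 2 <= expR (y / 2) ^+ 2.
    by rewrite lerXn2r// nnegrE ?expR_ge0//; lra.
  rewrite -expRM_natl (_ : 2%:R * (y / 2) = y); last by field.
  rewrite exprMn exprVn => hy.
  have -> : expR (2 * y) = expR y * expR y by rewrite -expRD; congr expR; ring.
  by rewrite mulrA ler_wpM2r ?expR_ge0//; lra.
have {}sq : (r * y) ^+ 2 * expR y <= r ^+ 2 * (4 * expR (2 * y)).
  by rewrite exprMn -mulrA ler_wpM2l ?sqr_ge0.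
have eyy : 1 <= expR y by rewrite -expR0 ler_expR.
have sq' : (r * y) ^+ 2 <= (r * y) ^+ 2 * expR y by rewrite ler_peMr ?sqr_ge0.
have sq'' : (r * y) ^+ 2 * expR (r * y) <= (r * y) ^+ 2 * expR y.
  by rewrite ler_wpM2l ?sqr_ge0// ler_expR.
have [x1|x1] := leP 1 x.
- have := young_relent (r * y) x0; have := expR_quadratic ry0.
  rewrite ger0_norm ?subr_ge0// mulrA; lra.
- have := young_relent (- (r * y)) x0; have := expRN_quadratic ry0.
  rewrite ltr0_norm ?subr_lt0// mulrA; lra.
Qed.

(** Used with [a] a value of a convex function and [t * y - b] a supporting line of
    it. The part of [|x - 1|] that comes from [x] is controlled by Young's
    inequality at [t * y - b], the part that comes from 1 by
    [1 + a <= expR a]. *)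
Lemma young_relent_convex (x y t b : R) (a : R) : 0 <= x -> 0 <= t * y ->
    t * y <= a + b ->
  t * (y * `|x - 1|) + 2 <= relent x + 2 * expR a + b * x + b.
Proof.
move=> x0 ty0 tyab.
have h1 : t * y * `|x - 1| <= t * y * x + t * y.
  rewrite -[X in _ <= _ + X]mulr1 -mulrDr ler_wpM2l// ler_norml; lra.
have := young_relent (t * y - b) x0.
have : expR (t * y - b) <= expR a by rewrite ler_expR; lra.
have := expR_ge1Dx a; rewrite mulrA; lra.
Qed.

End entropy_function.

Section rate_inequality.
Context {R : realType} (alpha : R -> R).
Hypotheses (alpha0 : alpha 0 = 0)
  (alpha_ge0 : forall t : R, 0 <= t -> 0 <= alpha t)
  (alpha_incr : forall s t : R, 0 <= s -> s <= t -> alpha s <= alpha t)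
  (alpha_convex : @convex_function R R^o `[0, +oo[%classic alpha).
Variables (k M K s1 : R).
Hypotheses (k0 : 0 < k) (M2 : 2 <= M) (K0 : 0 < K) (s10 : 0 < s1)
  (quad : forall s : R, 0 <= s <= s1 -> alpha s <= K * s ^+ 2).

(** The three terms serve, in this order, the regime of large costs (where [J / 2]
    is needed), the membership of [J / rate_constant] in the interval from 0 to [s1]
    where [alpha] is quadratic, and the size of the quadratic factor. *)
Definition rate_constant : R := 2 + 2 * M / (k * s1) + 4 * M * K / k ^+ 2.

Lemma rate_constant_gt0 : 0 < rate_constant.
Proof.
rewrite /rate_constant.
have M0 : 0 < M by apply: lt_le_trans M2.
have : 0 < 2 * M / (k * s1) by rewrite divr_gt0 ?mulr_gt0.
have : 0 < 4 * M * K / k ^+ 2 by rewrite divr_gt0 ?mulr_gt0 ?exprn_gt0.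
lra.
Qed.

(** If [k * J <= 2 * M], the quadratic hypothesis at the optimal value
    [r = k * J / (2 * M)] gives [(k * J) ^+ 2 / (4 * M) <= H], which dominates
    [alpha] near 0. Otherwise [r = 1] gives [2 <= M < H], and the supporting line
    at [J / 2] gives [2 * alpha (J / 2) <= H + 2 <= 2 * H]. *)
Lemma rate_inequality (J H : R) : 0 <= J ->
  (forall r : R, 0 <= r <= 1 -> r * (k * J) <= H + r ^+ 2 * M) ->
  (forall t b : R, 0 <= t -> 0 <= b -> (forall u : R, 0 <= u -> t * u <= alpha u + b) ->
    t * J <= H + 2 * b + 2) ->
  alpha (J / rate_constant) <= H.
Proof.
move=> J0 Hsmall Hlarge; have C0 := rate_constant_gt0.
have M0 : 0 < M by apply: lt_le_trans M2.
have c1 : 0 < 2 * M / (k * s1) by rewrite divr_gt0 ?mulr_gt0.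
have c2 : 0 < 4 * M * K / k ^+ 2 by rewrite divr_gt0 ?mulr_gt0 ?exprn_gt0.
have kJ0 : 0 <= k * J by rewrite mulr_ge0// ltW.
have JC0 : 0 <= J / rate_constant by rewrite divr_ge0// ltW.
have [kJ|kJ] := leP (k * J) (2 * M).
- have r01 : 0 <= k * J / (2 * M) <= 1.
    by rewrite divr_ge0//= ?ler_pdivrMr ?mul1r//; lra.
  have := Hsmall _ r01.
  have -> : k * J / (2 * M) * (k * J) = 2 * ((k * J) ^+ 2 / (4 * M)).
    by field; apply/eqP; lra.
  have -> : (k * J / (2 * M)) ^+ 2 * M = (k * J) ^+ 2 / (4 * M).
    by field; apply/eqP; lra.
  move=> h; apply: (@le_trans _ _ ((k * J) ^+ 2 / (4 * M))); last by lra.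
  apply: le_trans (quad _) _.
    rewrite JC0/= ler_pdivrMr// /rate_constant.
    have : J <= s1 * (2 * M / (k * s1)).
      have -> : s1 * (2 * M / (k * s1)) = 2 * M / k.
        by field; rewrite !gt_eqF.
      by rewrite ler_pdivlMr// mulrC.
    have : 0 <= s1 * (2 + 4 * M * K / k ^+ 2) by rewrite mulr_ge0// ?(ltW s10)// addr_ge0// ltW.
    rewrite !mulrDr; lra.
  have C1 : 4 * M * K / k ^+ 2 <= rate_constant ^+ 2.
    rewrite expr2; have : rate_constant <= rate_constant * rate_constant.
      by rewrite ler_peMl ?(ltW C0)//; move: c1 c2; rewrite /rate_constant; lra.
    rewrite {1}/rate_constant; lra.
  rewrite expr_div_n mulrA ler_pdivrMr ?exprn_gt0//.
  have -> : K * J ^+ 2 = (k * J) ^+ 2 / (4 * M) * (4 * M * K / k ^+ 2).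
    by field; apply/andP; split; rewrite gt_eqF//; lra.
  by rewrite ler_wpM2l// divr_ge0 ?sqr_ge0//; lra.
- have r1 : 0 <= (1 : R) <= 1 by lra.
  have := Hsmall _ r1; rewrite mul1r expr1n mul1r => Hlarge'.
  have J2 : 0 < J / 2.
    have : 0 < k * J by lra.
    by rewrite pmulr_rgt0//; lra.
  have [t t0 sub] := convex_rate_subgradient alpha0 alpha_ge0 alpha_convex J2.
  have b0 : 0 <= t * (J / 2) - alpha (J / 2).
    by have := sub 0 (lexx 0); rewrite alpha0; lra.
  have := Hlarge _ _ t0 b0 (fun u u0 => ltac:(have := sub u u0; lra)).
  have : alpha (J / rate_constant) <= alpha (J / 2).
    apply: alpha_incr => //; rewrite ler_wpM2l// lef_pV2 ?posrE//.
    by rewrite /rate_constant; lra.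
  move: M2; lra.
Qed.

End rate_inequality.

(** * Densities and mixtures *)

Section density_measure.
Context d (T : measurableType d) (R : realType).
Variables (mu : {sigma_finite_measure set T -> \bar R}) (g : T -> R).
Hypotheses (g0 : forall x, 0 <= g x) (intg : mu.-integrable setT (EFin \o g)).

(** The proofs are arguments so that the measure instances below depend on them. *)
Definition density_measure of (forall x, 0 <= g x) &
  mu.-integrable setT (EFin \o g) : set T -> \bar R :=
  fun A => (\int[mu]_(x in A) (g x)%:E)%E.

Local Notation nu := (density_measure g0 intg).

Let nu0 : nu set0 = 0%E. Proof. exact: integral_set0. Qed.

Let nu_ge0 A : (0 <= nu A)%E.
Proof. by apply: integral_ge0 => x _; rewrite lee_fin. Qed.

Let nu_sigma_additive : semi_sigma_additive nu.
Proof.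
by apply: semi_sigma_additive_nng_induced => [|x];
  [exact: measurable_int intg|rewrite lee_fin].
Qed.

HB.instance Definition _ := isMeasure.Build _ _ _ nu nu0 nu_ge0 nu_sigma_additive.

Let nu_fin : fin_num_fun nu.
Proof.
move=> A mA; apply: integrable_fin_num => //.
by apply: integrableS intg.
Qed.

HB.instance Definition _ := Measure_isFinite.Build _ _ _ nu nu_fin.

Lemma density_measure_dominates : nu `<< mu.
Proof.
apply/null_content_dominatesP => A mA muA0.
apply: null_set_integral => //.
by apply/measurable_funTS; exact: measurable_int intg.
Qed.

(** The density is almost everywhere equal to the Radon-Nikodym derivative of the
    measure that it defines, for which the change of variables is known. *)
Lemma integral_density_measure (f : T -> \bar R) : (forall x, 0 <= f x)%E ->
  measurable_fun setT f ->
  (\int[nu]_x f x = \int[mu]_x (f x * (g x)%:E))%E.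
Proof.
move=> f0 mf.
have mrn := measurable_int _
  (Radon_Nikodym_SigmaFinite.f_integrable density_measure_dominates).
have mg := measurable_int _ intg.
have rn0 := Radon_Nikodym_SigmaFinite.f_ge0 density_measure_dominates.
rewrite -(Radon_Nikodym_SigmaFinite.change_of_variables
  density_measure_dominates f0 measurableT mf).
apply: ae_eq_integral => //; try exact: emeasurable_funM.
apply: ae_eqe_mul2l; apply: integral_ae_eq => //.
  exact: Radon_Nikodym_SigmaFinite.f_integrable density_measure_dominates.
move=> A _ mA.
by rewrite -(Radon_Nikodym_SigmaFinite.f_integral density_measure_dominates mA).
Qed.

End density_measure.

Section unit_mass.
Context d (T : measurableType d) (R : realType) (m : {measure set T -> \bar R}).
Hypothesis m1 : m setT = 1%E.

Definition unit_mass of m setT = 1%E : set T -> \bar R := m.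

HB.instance Definition _ := Measure.on (unit_mass m1).
HB.instance Definition _ := Measure_isProbability.Build _ _ _ (unit_mass m1) m1.

End unit_mass.

(** The mixture is the bind of the Giry monad applied to the mixing measure and
    the family. *)
Lemma integral_mixture d d' (Theta : measurableType d) (T : measurableType d')
    (R : realType) (m : probability Theta R) (mu : Theta -> probability T R)
    (mmu : measurable_family mu) (f : T -> \bar R) :
  (forall x, 0 <= f x)%E -> measurable_fun setT f ->
  (\int[mixture m mmu]_x f x = \int[m]_theta \int[mu theta]_x f x)%E.
Proof.
move=> f0 mf.
pose k (theta : Theta) : giry T R := mu theta.
have mk : measurable_fun setT k by apply: measurable_giry_codensity => // B mB; exact: mmu.
transitivity (giry_int (giry_bind (m : giry Theta R) mk) f); last first.
  by rewrite giry_int_bind.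
rewrite /giry_int; apply: eq_measure_integral => A mA _ /=.
transitivity (giry_int (giry_map mk (m : giry Theta R)) (giry_ev ^~ A)) => //.
by rewrite giry_int_map//; exact: measurable_giry_ev.
Qed.

(** * Measurability of the distance *)

Section metric_borel.
Context {R : realType} (E : completeMetricType R).

Lemma open_mball (x : E) (r : R) : open (ball x r).
Proof.
rewrite openE => y; rewrite ballEmdist/= => xyr.
apply/nbhs_ballP; exists (r - mdist x y); first by rewrite /= subr_gt0.
move=> z; rewrite !ballEmdist/= => yz.
by have := metric_triangle x y z; lra.
Qed.

Lemma measurable_mdist (q : E) :
  measurable_fun setT (fun x : borel E => mdist (x : E) q).
Proof.
apply: (measurability (@RGenInftyO.G R)) => [|/= _ [_ [r ->] <-]].
  exact: RGenInftyO.measurableE.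
rewrite setTI; apply: sub_sigma_algebra.
suff -> : (fun x : borel E => mdist (x : E) q) @^-1` [set` `]-oo, r[ ] = ball q r.
  exact: open_mball.
by apply/seteqP; split => x; rewrite ballEmdist/= in_itv/= metric_sym.
Qed.

(** The triangle inequality writes the set where [d(x, y) < r] as the union, over a
    countable dense set of points [q], of the sets where
    [d(x, q) + d(y, q) < r], which involve one coordinate at a time. *)
Lemma measurable_mdist2 : separable E ->
  measurable_fun setT
    (fun z : (borel E * borel E)%type => mdist (z.1 : E) (z.2 : E)).
Proof.
move=> [D cD dD].
apply: (measurability (@RGenInftyO.G R)) => [|/= _ [_ [r ->] <-]].
  exact: RGenInftyO.measurableE.
rewrite setTI.
pose F (q : E) := (fun z : (borel E * borel E)%type =>
  mdist (z.1 : E) q + mdist (z.2 : E) q) @^-1` [set` `]-oo, r[ ].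
suff -> : (fun z : (borel E * borel E)%type => mdist (z.1 : E) (z.2 : E)) @^-1`
    [set` `]-oo, r[ ] = \bigcup_(q in D) F q.
  rewrite bigcup_set_type; apply: countable_bigcupT_measurable.
    by rewrite (eq_countable (card_setT _)).
  move=> i; rewrite /F -[X in measurable X]setTI.
  apply: measurable_funD => //.
  - exact: measurableT_comp (measurable_mdist _) measurable_fst.
  - exact: measurableT_comp (measurable_mdist _) measurable_snd.
apply/seteqP; split => -[x y] /=; rewrite in_itv/=.
- move=> xyr; have e0 : 0 < (r - mdist (x : E) (y : E)) / 2 by lra.
  have [||q []] := dD (ball (x : E) ((r - mdist (x : E) (y : E)) / 2)).
  + exists x; exact: ballxx.
  + exact: open_mball.
  + rewrite ballEmdist/= => xq Dq; exists q => //.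
    rewrite /F/= in_itv/=.
    have := metric_triangle (y : E) x q; rewrite (metric_sym (y : E) x); lra.
- move=> [q Dq]; rewrite /F/= in_itv/= => h.
  have := metric_triangle (x : E) q y; rewrite (metric_sym q y); lra.
Qed.

End metric_borel.

(** * Couplings *)

Lemma ge0_fin_integrable d (T : measurableType d) (R : realType)
    (mu : {measure set T -> \bar R}) (f : T -> R) :
  (forall x, 0 <= f x) -> measurable_fun setT f ->
  (\int[mu]_x (f x)%:E < +oo)%E -> mu.-integrable setT (EFin \o f).
Proof.
move=> f0 mf fy; apply/integrableP; split; first exact/measurable_EFinP.
by under eq_integral do rewrite /= ger0_norm//.
Qed.

Lemma integral_product_tensor d d' (T : measurableType d) (T' : measurableType d')
    (R : realType) (mu : probability T R) (nu : probability T' R)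
    (f : T -> R) (g : T' -> R) :
  (forall x, 0 <= f x) -> (forall y, 0 <= g y) ->
  measurable_fun setT f -> measurable_fun setT g ->
  (\int[(mu \x nu)%E]_z (f z.1 * g z.2)%:E =
   (\int[mu]_x (f x)%:E) * (\int[nu]_y (g y)%:E))%E.
Proof.
move=> f0 g0 mf mg.
have mfg : measurable_fun setT (fun z : T * T' => (f z.1 * g z.2)%:E).
  apply/measurable_EFinP; apply: measurable_funM.
  - exact: measurableT_comp mf measurable_fst.
  - exact: measurableT_comp mg measurable_snd.
rewrite fubini_tonelli1//; last by move=> z; rewrite lee_fin mulr_ge0.
have mfE : measurable_fun setT (fun x => (f x)%:E) by exact/measurable_EFinP.
have mgE : measurable_fun setT (fun y => (g y)%:E) by exact/measurable_EFinP.
have f0E x : (0 <= (f x)%:E)%E by rewrite lee_fin.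
have g0E : (0 <= \int[nu]_y (g y)%:E)%E by apply: integral_ge0 => y _; rewrite lee_fin.
rewrite -ge0_integralZr//.
apply: eq_integral => x _; rewrite /fubini_F/=.
under eq_integral do rewrite EFinM.
by rewrite ge0_integralZl// => y _; rewrite lee_fin.
Qed.

Section coupling_marginals.
Context {R : realType} (E : completeMetricType R).
Variables (mu nu : probability (borel E) R).

Lemma integral_fst_coupling pi (f : borel E -> \bar R) : coupling mu nu pi ->
  measurable_fun setT f -> (forall x, 0 <= f x)%E ->
  (\int[pi]_z f z.1 = \int[mu]_x f x)%E.
Proof.
move=> [pi1 _] mf f0.
transitivity (\int[pushforward pi (fst : borel E * borel E -> borel E)]_x f x)%E.
  by rewrite ge0_integral_pushforward//; exact: measurable_fst.
by apply: eq_measure_integral => A mA _; rewrite /= /pushforward pi1.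
Qed.

Lemma integral_snd_coupling pi (f : borel E -> \bar R) : coupling mu nu pi ->
  measurable_fun setT f -> (forall x, 0 <= f x)%E ->
  (\int[pi]_z f z.2 = \int[nu]_x f x)%E.
Proof.
move=> [_ pi2] mf f0.
transitivity (\int[pushforward pi (snd : borel E * borel E -> borel E)]_x f x)%E.
  by rewrite ge0_integral_pushforward//; exact: measurable_snd.
by apply: eq_measure_integral => A mA _; rewrite /= /pushforward pi2.
Qed.

Hypothesis sepE : separable E.
Variable x0 : E.

Let md (x : borel E) : R := mdist (x : E) x0.

Let md0 x : 0 <= md x. Proof. exact: mdist_ge0. Qed.

Let mmd : measurable_fun setT md. Proof. exact: measurable_mdist. Qed.

Let mmdE : measurable_fun setT (EFin \o md). Proof. exact/measurable_EFinP. Qed.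

(** The easy half of Kantorovich duality for the 1-Lipschitz function
    [d(., x0)]: integrate the triangle inequality against any coupling. *)
Lemma first_moment_le_transport_cost : first_moment x0 mu \is a fin_num ->
  (first_moment x0 nu <= transport_cost mu nu + first_moment x0 mu)%E.
Proof.
move=> Bfin; rewrite -leeBlDr//.
apply: le_ereal_inf_tmp => _ [pi cpi <-]; rewrite leeBlDr//.
have md0E x : (0 <= (EFin \o md) x)%E by rewrite lee_fin.
rewrite /first_moment -(integral_snd_coupling cpi mmdE md0E).
rewrite -(integral_fst_coupling cpi mmdE md0E).
have mfst : measurable_fun setT (fun z : (borel E * borel E)%type => (md z.1)%:E).
  exact: measurableT_comp mmdE measurable_fst.
have msnd : measurable_fun setT (fun z : (borel E * borel E)%type => (md z.2)%:E).
  exact: measurableT_comp mmdE measurable_snd.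
have md2 : measurable_fun setT (fun z : (borel E * borel E)%type =>
    (mdist (z.1 : E) (z.2 : E))%:E).
  by apply/measurable_EFinP; exact: measurable_mdist2.
have d0 (z : borel E * borel E) : (0 <= (mdist (z.1 : E) (z.2 : E))%:E)%E.
  by rewrite lee_fin mdist_ge0.
rewrite -ge0_integralD//.
apply: ge0_le_integral => //.
- exact: emeasurable_funD.
- move=> z _; rewrite -EFinD lee_fin (metric_sym (z.1 : E)).
  exact: metric_triangle.
Qed.

End coupling_marginals.

Section coupling_density.
Context {R : realType} (E : completeMetricType R).
Variables (mu nu : probability (borel E) R) (F : borel E -> R).
Hypotheses (F0 : forall x, 0 <= F x) (mF : measurable_fun setT F)
  (nuF : forall A, measurable A -> nu A = (\int[mu]_(x in A) (F x)%:E)%E).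

(* [p] is the density of the common part of [mu] and [nu]; [u] and [v] are the
   densities of the excesses of [mu] and of [nu], of equal mass [tau]. *)
Let p (x : borel E) := Num.min (F x) 1.
Let u (x : borel E) := Num.max (1 - F x) 0.
Let v (x : borel E) := Num.max (F x - 1) 0.

Let p0 x : 0 <= p x. Proof. by rewrite /p le_min F0 ler01. Qed.
Let u0 x : 0 <= u x. Proof. by rewrite /u le_max lexx orbT. Qed.
Let v0 x : 0 <= v x. Proof. by rewrite /v le_max lexx orbT. Qed.
Let pu x : p x + u x = 1.
Proof.
by rewrite /p /u; case: (lerP (F x) 1) => h;
  case: (lerP (1 - F x) 0) => h'; lra.
Qed.
Let pv x : p x + v x = F x.
Proof.
by rewrite /p /v; case: (lerP (F x) 1) => h;
  case: (lerP (F x - 1) 0) => h'; lra.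
Qed.
Let uv x : u x + v x = `|F x - 1|.
Proof.
by rewrite /u /v; case: (ger0P (F x - 1)) => h;
  case: (lerP (F x - 1) 0) => h'; case: (lerP (1 - F x) 0) => h''; lra.
Qed.

Let mp : measurable_fun setT p. Proof. exact: measurable_minr. Qed.
Let m_u : measurable_fun setT u.
Proof. by apply: measurable_maxr => //; exact: measurable_funB. Qed.
Let mv : measurable_fun setT v.
Proof. by apply: measurable_maxr => //; exact: measurable_funB. Qed.

Let intF : (\int[mu]_x (F x)%:E = 1)%E.
Proof. by rewrite -nuF// probability_setT. Qed.

Let tau : R := fine (\int[mu]_x (u x)%:E)%E.

Let int_split (f g h : borel E -> R) (A : set (borel E)) : measurable A ->
  (forall x, f x + g x = h x) -> (forall x, 0 <= f x) -> (forall x, 0 <= g x) ->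
  measurable_fun setT f -> measurable_fun setT g ->
  (\int[mu]_(x in A) (f x)%:E + \int[mu]_(x in A) (g x)%:E =
   \int[mu]_(x in A) (h x)%:E)%E.
Proof.
move=> mA fgh f0 g0 mf mg; rewrite -ge0_integralD//.
- by apply: eq_integral => x _; rewrite -EFinD fgh.
- by move=> x _; rewrite lee_fin.
- by apply/measurable_EFinP; exact: measurable_funTS.
- by move=> x _; rewrite lee_fin.
- by apply/measurable_EFinP; exact: measurable_funTS.
Qed.

Let int1 (A : set (borel E)) : measurable A -> (\int[mu]_(x in A) 1%:E = mu A)%E.
Proof. by move=> mA; rewrite integral_cst// mul1e. Qed.

Let intu : (\int[mu]_x (u x)%:E = tau%:E)%E.
Proof.
have := int_split measurableT pu p0 u0 mp m_u.
rewrite int1// probability_setT /tau => h; rewrite fineK// ge0_fin_numE.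
  apply: (@le_lt_trans _ _ 1%E); last exact: ltry.
  by rewrite -h leeDr// integral_ge0// => x _; rewrite lee_fin.
by apply: integral_ge0 => x _; rewrite lee_fin.
Qed.

Let intp : (\int[mu]_x (p x)%:E \is a fin_num)%E.
Proof.
have := int_split measurableT pu p0 u0 mp m_u.
rewrite int1// probability_setT => h; rewrite ge0_fin_numE.
  apply: (@le_lt_trans _ _ 1%E); last exact: ltry.
  by rewrite -h leeDl// integral_ge0// => x _; rewrite lee_fin.
by apply: integral_ge0 => x _; rewrite lee_fin.
Qed.

Let intv : (\int[mu]_x (v x)%:E = tau%:E)%E.
Proof.
have := int_split measurableT pv p0 v0 mp mv.
rewrite intF; have := int_split measurableT pu p0 u0 mp m_u.
rewrite int1// probability_setT -intu.
set P := (\int[mu]_x (p x)%:E)%E; set U := (\int[mu]_x (u x)%:E)%E.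
set V := (\int[mu]_x (v x)%:E)%E => PU PV.
by rewrite -(addeK V intp) -(addeK U intp) (addeC V) (addeC U) PU PV.
Qed.

Let tau0 : 0 <= tau.
Proof. by rewrite -lee_fin -intu integral_ge0// => x _; rewrite lee_fin. Qed.

(* For [tau = 0] the convention [0^-1 = 0] applies; the identity holds because [c]
   vanishes as well. *)
Let tau_cancel c : 0 <= c <= tau -> c * (tau / tau) = c.
Proof.
have [->|t0] := eqVneq tau 0; last by rewrite divff// mulr1.
by move=> h; rewrite mul0r mulr0; apply/esym/eqP; rewrite eq_le andbC.
Qed.

Let weight (z : (borel E * borel E)%type) := u z.1 * (v z.2 / tau).

Let weight0 z : 0 <= weight z.
Proof. by rewrite /weight mulr_ge0// divr_ge0. Qed.

Let mweight : measurable_fun setT weight.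
Proof.
apply: measurable_funM; first exact: measurableT_comp m_u measurable_fst.
apply: measurable_funM => //; exact: measurableT_comp mv measurable_snd.
Qed.

Let vt0 x : 0 <= v x / tau. Proof. by rewrite divr_ge0. Qed.

Let mvt : measurable_fun setT (fun x => v x / tau).
Proof. exact: measurable_funM. Qed.

Let intvt : (\int[mu]_x (v x / tau)%:E = (tau / tau)%:E)%E.
Proof.
have mvE : measurable_fun setT (fun x => (v x)%:E) by exact/measurable_EFinP.
under eq_integral do rewrite EFinM.
rewrite ge0_integralZr ?intv//; first by move=> x _; rewrite lee_fin.
by rewrite lee_fin invr_ge0.
Qed.

Let integrable_p : mu.-integrable setT (EFin \o p).
Proof. by apply: ge0_fin_integrable => //; rewrite ltey_eq intp. Qed.

Let mumu : probability (borel E * borel E)%type R := (mu \x mu)%E.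

Let integrable_weight : mumu.-integrable setT (EFin \o weight).
Proof.
apply: ge0_fin_integrable => //.
by rewrite (integral_product_tensor mu mu u0 vt0 m_u mvt) intu intvt -EFinM ltry.
Qed.

Let diag (x : borel E) : (borel E * borel E)%type := (x, x).

Let mdiag : measurable_fun setT diag.
Proof. exact: measurable_fun_pair. Qed.

(** The common part of [mu] and [nu], carried by the diagonal: this mass does not
    move. *)
Definition overlap_measure : {measure set (borel E * borel E) -> \bar R}.
Proof.
unshelve refine (pushforward (density_measure p0 integrable_p) diag
  : {measure set (borel E * borel E)%type -> \bar R}).
exact: mdiag.
Defined.

(** The excess of [mu] is sent to the excess of [nu] independently. For [tau = 0]
    the weight vanishes and the overlap is already a coupling. *)
Definition excess_measure : {measure set (borel E * borel E) -> \bar R} :=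
  density_measure (mu := mumu) weight0 integrable_weight.

Definition coupling_measure : {measure set (borel E * borel E) -> \bar R} :=
  measure_add overlap_measure excess_measure.

Let integral_coupling f : (forall z, 0 <= f z)%E -> measurable_fun setT f ->
  (\int[coupling_measure]_z f z = \int[mu]_x (f (x, x) * (p x)%:E) +
     \int[mumu]_z (f z * (weight z)%:E))%E.
Proof.
move=> f0 mf; rewrite ge0_integral_measure_add// integral_density_measure//.
congr (_ + _)%E; rewrite -integral_density_measure//; last exact: measurableT_comp mf mdiag.
by rewrite ge0_integral_pushforward.
Qed.

Let tau_ratio_le1 : tau / tau <= 1.
Proof. by have [->|t0] := eqVneq tau 0; rewrite ?mul0r ?divff. Qed.

Let tau_cancelE (X : \bar R) : (0 <= X <= tau%:E)%E -> (X * (tau / tau)%:E)%E = X.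
Proof.
case: X => [c| |]//=; first by rewrite !lee_fin => /tau_cancel h; rewrite -EFinM h.
by rewrite leye_eq/= andbF.
Qed.

Let ge0_cstmul (f : borel E -> R) c : (forall x, 0 <= f x) -> 0 <= c ->
  measurable_fun setT f ->
  (\int[mu]_x (f x * c)%:E = (\int[mu]_x (f x)%:E) * c%:E)%E.
Proof.
move=> f0 c0 mf; under eq_integral do rewrite EFinM.
have mfE : measurable_fun setT (EFin \o f) by exact/measurable_EFinP.
by rewrite ge0_integralZr// => x _; rewrite lee_fin.
Qed.

Let tensor_fst (f : borel E -> R) : (forall x, 0 <= f x) -> measurable_fun setT f ->
  (\int[mumu]_z (f z.1 * (v z.2 / tau))%:E =
   (\int[mu]_x (f x)%:E) * (tau / tau)%:E)%E.
Proof.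
by move=> f0 mf; rewrite (integral_product_tensor mu mu f0 vt0 mf mvt) intvt.
Qed.

Let tensor_snd (f : borel E -> R) : (forall x, 0 <= f x) -> measurable_fun setT f ->
  (\int[mumu]_z (u z.1 * (f z.2 / tau))%:E =
   (\int[mu]_x (f x)%:E) * (tau / tau)%:E)%E.
Proof.
move=> f0 mf.
have ft0 x : 0 <= f x / tau by rewrite divr_ge0.
have mft : measurable_fun setT (fun x => f x / tau) by exact: measurable_funM.
rewrite (integral_product_tensor mu mu u0 ft0 m_u mft) intu ge0_cstmul ?invr_ge0//.
by rewrite muleCA -EFinM.
Qed.

Let integral_restr (f : borel E -> R) A : measurable A ->
  (\int[mu]_x (\1_A x * f x)%:E = \int[mu]_(x in A) (f x)%:E)%E.
Proof.
move=> mA; rewrite [RHS]integral_mkcond epatch_indic.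
by apply: eq_integral => x _; rewrite /= EFinM muleC.
Qed.

Let restr_le (f : borel E -> R) A : measurable A -> (forall x, 0 <= f x) ->
  measurable_fun setT f ->
  (0 <= \int[mu]_(x in A) (f x)%:E <= \int[mu]_x (f x)%:E)%E.
Proof.
move=> mA f0 mf; apply/andP; split.
  by apply: integral_ge0 => x _; rewrite lee_fin.
apply: ge0_subset_integral => //; first exact/measurable_EFinP.
by move=> x _; rewrite lee_fin.
Qed.

Let mind (A : set (borel E)) (f : borel E -> R) : measurable A ->
  measurable_fun setT f -> measurable_fun setT (fun x => \1_A x * f x).
Proof. by move=> mA mf; apply: measurable_funM. Qed.

Let ind0 (A : set (borel E)) (f : borel E -> R) : (forall x, 0 <= f x) ->
  forall x, 0 <= \1_A x * f x.
Proof. by move=> f0 x; rewrite mulr_ge0. Qed.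

Let coupling_fst A : measurable A -> coupling_measure (fst @^-1` A) = mu A.
Proof.
move=> mA.
have mA1 : measurable (fst @^-1` A : set (borel E * borel E)).
  by rewrite -[X in measurable X]setTI; exact: measurable_fst.
transitivity (\int[coupling_measure]_z (\1_(fst @^-1` A) z)%:E)%E.
  by rewrite integral_indic// setIT.
have ind0E z : (0 <= (\1_(fst @^-1` A : set (borel E * borel E)) z : R)%:E)%E.
  by rewrite lee_fin.
have mindE : measurable_fun setT
    (fun z => (\1_(fst @^-1` A : set (borel E * borel E)) z : R)%:E).
  exact/measurable_EFinP.
rewrite integral_coupling//.
rewrite [X in (_ + X)%E](_ : _ =
    (\int[mu]_x (\1_A x * u x)%:E) * (tau / tau)%:E)%E; last first.
  rewrite -(tensor_fst (ind0 A u0) (mind mA m_u)); apply: eq_integral => z _.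
  rewrite -EFinM /weight (_ : \1_(fst @^-1` A) z = \1_A z.1) ?indicE//.
  by congr EFin; ring.
rewrite (integral_restr u mA).
rewrite tau_cancelE; last by rewrite -intu (restr_le mA u0 m_u).
rewrite -(int1 mA) -(int_split mA pu p0 u0 mp m_u); congr (_ + _)%E.
rewrite -(integral_restr p mA); apply: eq_integral => x _.
by rewrite EFinM !indicE.
Qed.

Let coupling_snd A : measurable A -> coupling_measure (snd @^-1` A) = nu A.
Proof.
move=> mA.
have mA1 : measurable (snd @^-1` A : set (borel E * borel E)).
  by rewrite -[X in measurable X]setTI; exact: measurable_snd.
transitivity (\int[coupling_measure]_z (\1_(snd @^-1` A) z)%:E)%E.
  by rewrite integral_indic// setIT.
have ind0E z : (0 <= (\1_(snd @^-1` A : set (borel E * borel E)) z : R)%:E)%E.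
  by rewrite lee_fin.
have mindE : measurable_fun setT
    (fun z => (\1_(snd @^-1` A : set (borel E * borel E)) z : R)%:E).
  exact/measurable_EFinP.
rewrite integral_coupling//.
rewrite [X in (_ + X)%E](_ : _ =
    (\int[mu]_x (\1_A x * v x)%:E) * (tau / tau)%:E)%E; last first.
  rewrite -(tensor_snd (ind0 A v0) (mind mA mv)); apply: eq_integral => z _.
  rewrite -EFinM /weight (_ : \1_(snd @^-1` A) z = \1_A z.2) ?indicE//.
  by congr EFin; ring.
rewrite (integral_restr v mA).
rewrite tau_cancelE; last by rewrite -intv (restr_le mA v0 mv).
rewrite nuF// -(int_split mA pv p0 v0 mp mv); congr (_ + _)%E.
rewrite -(integral_restr p mA); apply: eq_integral => x _.
by rewrite EFinM !indicE.
Qed.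

Let coupling_setT : coupling_measure setT = 1%E.
Proof. by rewrite -(preimage_setT fst) coupling_fst// probability_setT. Qed.

(** Only the excesses move, and a move from [x] to [y] is charged to a detour
    through [x0]; integrating out one coordinate leaves the integral of
    [d(., x0) * (u + v)], and [u + v = |F - 1|]. *)
Lemma transport_cost_le_weighted_variation (x0 : E) : separable E ->
  (transport_cost mu nu <=
   \int[mu]_x (mdist (x : E) x0 * `|F x - 1|)%:E)%E.
Proof.
move=> sepE; apply: ge_ereal_inf.
pose pi : probability (borel E * borel E)%type R := unit_mass coupling_setT.
exists (\int[pi]_z (mdist (z.1 : E) (z.2 : E))%:E)%E.
  by exists pi.
have -> : (\int[pi]_z (mdist (z.1 : E) (z.2 : E))%:E =
    \int[coupling_measure]_z (mdist (z.1 : E) (z.2 : E))%:E)%E by [].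
have md2 : measurable_fun setT (fun z : (borel E * borel E)%type =>
    (mdist (z.1 : E) (z.2 : E))%:E).
  by apply/measurable_EFinP; exact: measurable_mdist2.
have d0 (z : borel E * borel E) : (0 <= (mdist (z.1 : E) (z.2 : E))%:E)%E.
  by rewrite lee_fin mdist_ge0.
pose md (x : borel E) : R := mdist (x : E) x0.
have md0 x : 0 <= md x by exact: mdist_ge0.
have mmd : measurable_fun setT md by exact: measurable_mdist.
have dmu0 x : 0 <= md x * u x by rewrite mulr_ge0.
have dmv0 x : 0 <= md x * v x by rewrite mulr_ge0.
have mdu : measurable_fun setT (fun x => md x * u x) by exact: measurable_funM.
have mdv : measurable_fun setT (fun x => md x * v x) by exact: measurable_funM.
rewrite integral_coupling//.
rewrite [X in (X + _)%E]integral0_eq ?add0e; last first.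
  by move=> x _; rewrite /= mdistxx mul0e.
rewrite (eq_integral (fun x => (md x * u x)%:E + (md x * v x)%:E)%E); last first.
  by move=> x _; rewrite -EFinD -mulrDr uv.
have mduE : measurable_fun setT (fun x => (md x * u x)%:E) by exact/measurable_EFinP.
have mdvE : measurable_fun setT (fun x => (md x * v x)%:E) by exact/measurable_EFinP.
have dmu0E x : (0 <= (md x * u x)%:E)%E by rewrite lee_fin.
have dmv0E x : (0 <= (md x * v x)%:E)%E by rewrite lee_fin.
rewrite ge0_integralD//.
apply: (@le_trans _ _ (\int[mumu]_z ((md z.1 * u z.1 * (v z.2 / tau))%:E +
    (u z.1 * (md z.2 * v z.2 / tau))%:E))%E).
  apply: ge0_le_integral => //.
  - by move=> z _; rewrite mule_ge0// lee_fin.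
  - by apply: emeasurable_funM => //; exact/measurable_EFinP.
  - apply: emeasurable_funD; apply/measurable_EFinP.
    + apply: measurable_funM; first exact: measurableT_comp mdu measurable_fst.
      exact: measurableT_comp mvt measurable_snd.
    + apply: measurable_funM; first exact: measurableT_comp m_u measurable_fst.
      apply: measurable_funM => //; exact: measurableT_comp mdv measurable_snd.
  - move=> z _; rewrite -EFinM -EFinD lee_fin.
    have -> : md z.1 * u z.1 * (v z.2 / tau) + u z.1 * (md z.2 * v z.2 / tau) =
       (md z.1 + md z.2) * weight z by rewrite /weight; ring.
    rewrite ler_wpM2r// /md (metric_sym (z.2 : E)); exact: metric_triangle.
rewrite ge0_integralD//; last 4 first.
- by move=> z _; rewrite lee_fin mulr_ge0.
- apply/measurable_EFinP.
  apply: measurable_funM; first exact: measurableT_comp mdu measurable_fst.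
  exact: measurableT_comp mvt measurable_snd.
- by move=> z _; rewrite lee_fin !mulr_ge0// invr_ge0.
- apply/measurable_EFinP.
  apply: measurable_funM; first exact: measurableT_comp m_u measurable_fst.
  apply: measurable_funM => //; exact: measurableT_comp mdv measurable_snd.
rewrite (tensor_fst dmu0 mdu) (tensor_snd dmv0 mdv).
by apply: leeD; rewrite muleC; apply: gee_pMl; rewrite ?lee_fin// integral_ge0// => x _; rewrite lee_fin.
Qed.

End coupling_density.

(** * Relative entropy in terms of a density *)

Section relative_entropy_density.
Context d (T : measurableType d) (R : realType).
Implicit Types (mu nu : probability T R) (F : T -> R).

Lemma measurable_relent : measurable_fun setT (@relent R).
Proof.
apply: measurable_funD => //; apply: measurable_funB => //.
by apply: measurable_funM => //; exact: measurable_ln.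
Qed.

Lemma measurable_lne_EFin (f : T -> R) : measurable_fun setT f ->
  measurable_fun setT (fun x => lne (f x)%:E).
Proof.
move=> mf; apply: measurable_fun_ifT => //=.
  exact: measurable_fun_ler.
apply/measurable_EFinP; apply: measurableT_comp mf; exact: measurable_ln.
Qed.

Lemma exists_density mu nu : nu `<< mu ->
  exists F, [/\ forall x, 0 <= F x, measurable_fun setT F &
    forall A, measurable A -> nu A = (\int[mu]_(x in A) (F x)%:E)%E].
Proof.
move=> numu; pose f := Radon_Nikodym_SigmaFinite.f nu mu.
have fE x : f x = (fine (f x))%:E.
  by rewrite fineK//; exact: Radon_Nikodym_SigmaFinite.f_fin_num.
exists (fine \o f); split.
- by move=> x; apply: fine_ge0; exact: Radon_Nikodym_SigmaFinite.f_ge0.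
- apply: measurableT_comp => //.
  exact: measurable_int (Radon_Nikodym_SigmaFinite.f_integrable numu).
- move=> A mA; rewrite (Radon_Nikodym_SigmaFinite.f_integral numu mA).
  by apply: eq_integral => x _; rewrite -fE.
Qed.

Section given_density.
Variables (mu nu : probability T R) (F : T -> R).
Hypotheses (F0 : forall x, 0 <= F x) (mF : measurable_fun setT F)
  (nuF : forall A, measurable A -> nu A = (\int[mu]_(x in A) (F x)%:E)%E).

Let intF1 : (\int[mu]_x (F x)%:E = 1)%E.
Proof. by rewrite -nuF// probability_setT. Qed.

Let int1 : (\int[mu]_x 1%:E = 1)%E.
Proof. by rewrite integral_cst// mul1e; exact: probability_setT. Qed.

Lemma integrable_density : mu.-integrable setT (EFin \o F).
Proof. by apply: ge0_fin_integrable => //; rewrite intF1 ltry. Qed.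

Lemma density_dominates : nu `<< mu.
Proof.
apply/null_content_dominatesP => A mA muA0; rewrite nuF//.
apply: null_set_integral => //; apply/measurable_EFinP.
exact: measurable_funTS.
Qed.

Lemma integral_density f : (forall x, 0 <= f x)%E -> measurable_fun setT f ->
  (\int[nu]_x f x = \int[mu]_x (f x * (F x)%:E))%E.
Proof.
move=> f0 mf; rewrite -(integral_density_measure F0 integrable_density f0 mf).
by apply: eq_measure_integral => A mA _; rewrite /= nuF.
Qed.

Let rn := Radon_Nikodym (charge_of_finite_measure nu) mu.

Let mrn : measurable_fun setT rn.
Proof.
apply: (@measurable_int _ _ _ mu); apply: Radon_Nikodym_integrable.
exact: density_dominates.
Qed.

Let mlne_rn : measurable_fun setT (@lne R \o rn).
Proof.
rewrite (_ : @lne R \o rn = fun x => lne (fine (rn x))%:E); last first.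
  have rnE x : rn x = (fine (rn x))%:E.
    by rewrite fineK//; apply: Radon_Nikodym_fin_num; exact: density_dominates.
  by apply/funext => x; exact: (congr1 (@lne R) (rnE x)).
by apply: measurable_lne_EFin; exact: measurableT_comp mrn.
Qed.

Let rnF : ae_eq nu setT (@lne R \o rn) (fun x => lne (F x)%:E).
Proof.
have : ae_eq mu setT rn (EFin \o F).
  apply: integral_ae_eq => //.
  - by apply: Radon_Nikodym_integrable; exact: density_dominates.
  - exact/measurable_EFinP.
  - by move=> A _ mA; rewrite -nuF// -Radon_Nikodym_integral//; exact: density_dominates.
move/(null_dominates_ae_eq measurableT density_dominates).
by apply: filterS => x /= rnx _; rewrite rnx.
Qed.

Let P x := Num.max (F x * ln (F x)) 0.
Let N x := Num.max (- (F x * ln (F x))) 0.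

Let mFln : measurable_fun setT (fun x => F x * ln (F x)).
Proof. by apply: measurable_funM => //; exact: measurableT_comp. Qed.

Let mP : measurable_fun setT P. Proof. exact: measurable_maxr. Qed.

Let mN : measurable_fun setT N.
Proof. by apply: measurable_maxr => //; exact: measurable_funN. Qed.

Let P0 x : 0 <= P x. Proof. by rewrite /P le_max lexx orbT. Qed.
Let N0 x : 0 <= N x. Proof. by rewrite /N le_max lexx orbT. Qed.

(** Both sides are differences of the integrals of the positive and negative parts
    of [F ln F]; the negative part is at most 1, hence integrable, and
    [1 - F] integrates to 0. *)
Lemma relative_entropy_density :
  relative_entropy nu mu = (\int[mu]_x (relent (F x))%:E)%E.
Proof.
rewrite /relative_entropy asboolT; last exact: density_dominates.
have mlnF : measurable_fun setT (fun x => lne (F x)%:E).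
  exact: measurable_lne_EFin.
rewrite (ae_eq_integral _ _ measurableT mlne_rn mlnF rnF).
rewrite integralE.
rewrite !integral_density//; try exact: measurable_funepos; try exact: measurable_funeneg.
rewrite (eq_integral (EFin \o P)); last first.
  move=> x _; rewrite funeposE /P/=.
  have := F0 x; rewrite le_eqVlt => /predU1P[<-|Fx0].
    by rewrite lexx mule0 mul0r maxxx.
  rewrite leNgt Fx0/= -EFin_max -EFinM; congr EFin.
  by rewrite maxr_pMl ?(ltW Fx0)// mul0r mulrC.
rewrite [X in (_ - X)%E](eq_integral (EFin \o N)); last first.
  move=> x _; rewrite funenegE /N/=.
  have := F0 x; rewrite le_eqVlt => /predU1P[<-|Fx0].
    by rewrite lexx mule0 mul0r oppr0 maxxx.
  rewrite leNgt Fx0/= -EFin_max -EFinM; congr EFin.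
  by rewrite maxr_pMl ?(ltW Fx0)// mul0r mulNr mulrC.
have N1 : (\int[mu]_x (N x)%:E \is a fin_num)%E.
  rewrite ge0_fin_numE; last by apply: integral_ge0 => x _; rewrite lee_fin.
  apply: (@le_lt_trans _ _ (\int[mu]_x 1%:E)%E); last first.
    by rewrite int1 ltry.
  apply: ge0_le_integral => //; first by move=> x _; rewrite lee_fin.
    exact/measurable_EFinP.
  move=> x _; rewrite lee_fin /N ge_max ler01 andbT.
  have := relent_ge0 (F0 x); have := F0 x; rewrite /relent; lra.
have key : (\int[mu]_x (relent (F x))%:E + \int[mu]_x (N x)%:E + 1 =
            \int[mu]_x (P x)%:E + 1)%E.
  rewrite -{1}intF1 -[in RHS]int1.
  have rE x : (0 <= (relent (F x))%:E)%E by rewrite lee_fin relent_ge0.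
  have NE x : (0 <= (N x)%:E)%E by rewrite lee_fin.
  have PE x : (0 <= (P x)%:E)%E by rewrite lee_fin.
  have FE x : (0 <= (F x)%:E)%E by rewrite lee_fin.
  have mrE : measurable_fun setT (fun x => (relent (F x))%:E).
    by apply/measurable_EFinP; exact: measurableT_comp measurable_relent mF.
  have mNE : measurable_fun setT (fun x => (N x)%:E) by exact/measurable_EFinP.
  have mPE : measurable_fun setT (fun x => (P x)%:E) by exact/measurable_EFinP.
  have mFE : measurable_fun setT (fun x => (F x)%:E) by exact/measurable_EFinP.
  have mrNE : measurable_fun setT (fun x => (relent (F x))%:E + (N x)%:E)%E.
    exact: emeasurable_funD.
  have rNE x : (0 <= (relent (F x))%:E + (N x)%:E)%E by rewrite adde_ge0.
  rewrite -ge0_integralD// -ge0_integralD// -ge0_integralD//.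
  apply: eq_integral => x _; rewrite -!EFinD; congr EFin.
  rewrite /relent /P /N.
  by case: (lerP (F x * ln (F x)) 0) => h; case: (lerP (- (F x * ln (F x))) 0) => h'; lra.
have := congr1 (fun z => z - 1)%E key; rewrite !addeK// => <-.
by rewrite addeK.
Qed.

End given_density.
End relative_entropy_density.

(** * Tails and exponential moments from the transport inequality *)

(** The conditioned measure has density [1 / c] on [A], so its entropy is
    [ln (1 / c)]. *)
Lemma conditional_probability d (T : measurableType d) (R : realType)
    (mu : probability T R) (A : set T) (c : R) :
  measurable A -> 0 < c -> mu A = c%:E ->
  exists nu : probability T R,
    nu A = 1%E /\ relative_entropy nu mu = (- ln c)%:E.
Proof.
move=> mA c0 muA.
pose F (x : T) : R := \1_A x / c.
have F0 x : 0 <= F x by rewrite divr_ge0// ltW.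
have mF : measurable_fun setT F by exact: measurable_funM.
have FB B : measurable B -> (\int[mu]_(x in B) (F x)%:E = mu (A `&` B) * c^-1%:E)%E.
  move=> mB; have m1E : measurable_fun B (fun x => (\1_A x : R)%:E).
    by apply/measurable_EFinP; exact: measurable_funTS.
  under eq_integral do rewrite EFinM.
  rewrite ge0_integralZr// ?integral_indic//.
  by rewrite lee_fin invr_ge0 ltW.
have F1 : (\int[mu]_x (F x)%:E = 1)%E.
  by rewrite FB// setIT muA -EFinM divff// gt_eqF.
have iF : mu.-integrable setT (EFin \o F).
  by apply: ge0_fin_integrable => //; rewrite F1 ltry.
have nu1 : density_measure F0 iF setT = 1%E by [].
pose nu : probability T R := unit_mass nu1.
exists nu; split.
  have -> : nu A = (\int[mu]_(x in A) (F x)%:E)%E by [].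
  by rewrite FB// setIid muA -EFinM divff// gt_eqF.
rewrite (relative_entropy_density F0 mF)//.
have cV0 : 0 <= c^-1 by rewrite invr_ge0 ltW.
have r0 := relent_ge0 cV0.
have m1E (B : set T) : measurable B -> measurable_fun setT (fun x => (\1_B x : R)%:E).
  by move=> mB; apply/measurable_EFinP; exact: measurable_indic.
have mCA : measurable (~` A) by exact: measurableC.
rewrite (eq_integral (fun x => (\1_A x)%:E * (relent c^-1)%:E + (\1_(~` A) x)%:E)%E).
  have m1A := m1E _ mA; have m1CA := m1E _ mCA.
  have mAr : measurable_fun setT (fun x => (\1_A x)%:E * (relent c^-1)%:E)%E.
    exact: emeasurable_funM.
  have Ar0 x : (0 <= (\1_A x)%:E * (relent c^-1)%:E)%E by rewrite mule_ge0// lee_fin.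
  have i0 (B : set T) x : (0 <= (\1_B x : R)%:E)%E by rewrite lee_fin.
  rewrite ge0_integralD// ge0_integralZr//.
  have muCA : mu (~` A) = (1 - c)%:E by rewrite probability_setC// muA.
  rewrite !integral_indic//.
  transitivity (mu A * (relent c^-1)%:E + mu (~` A))%E; first by rewrite !setIT.
  rewrite muA muCA -EFinM -EFinD.
  congr EFin; rewrite /relent lnV ?posrE//; field; exact: lt0r_neq0.
move=> x _; rewrite -EFinM -EFinD; congr EFin; rewrite /F !indicE in_setC.
case: (x \in A) => /=; first by rewrite !mul1r addr0.
by rewrite /relent !mul0r subr0.
Qed.

Lemma extend_ge (R : realType) (alpha : R -> R) (t : R) (x : \bar R) :
  (forall s t : R, 0 <= s -> s <= t -> alpha s <= alpha t) ->
  0 <= t -> (t%:E <= x)%E -> ((alpha t)%:E <= extend alpha x)%E.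
Proof.
move=> ai t0; case: x => [r| |]//=; first by rewrite !lee_fin; exact: ai.
move=> _; apply: ereal_sup_ubound; exists t => //=.
by rewrite in_itv/= t0.
Qed.

Section transport_tail.
Context {R : realType} (alpha : R -> R).
Hypotheses (alpha0 : alpha 0 = 0)
  (alpha_ge0 : forall t : R, 0 <= t -> 0 <= alpha t)
  (alpha_incr : forall s t : R, 0 <= s -> s <= t -> alpha s <= alpha t)
  (alpha_convex : @convex_function R R^o `[0, +oo[%classic alpha).
Variables (k A : R).
Hypotheses (k0 : 0 < k) (lin : forall s : R, 0 <= s -> k * s <= alpha s + A).

Lemma measurable_rate d (T : measurableType d) (f : T -> R) :
  (forall x, 0 <= f x) -> measurable_fun setT f ->
  measurable_fun setT (fun x => alpha (f x)).
Proof.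
move=> f0 mf; pose a t := alpha (Num.max t 0).
rewrite (_ : (fun x => _) = a \o f).
  apply: measurableT_comp mf; apply: nondecreasing_measurable => // s t st.
  apply: alpha_incr; first by rewrite le_max lexx orbT.
  by rewrite ge_max !le_max st lexx !orbT.
by apply/funext => x; rewrite /a/= max_l.
Qed.

Variables (E : completeMetricType R) (sepE : separable E).
Variables (mu : probability (borel E) R) (x0 : E) (B : R).
Hypotheses (mu_T1 : T1 alpha mu) (muB : first_moment x0 mu = B%:E).

Let X (x : borel E) : R := Num.max (mdist (x : E) x0 - B) 0.

Let X0 x : 0 <= X x. Proof. by rewrite /X le_max lexx orbT. Qed.

Let mX : measurable_fun setT X.
Proof.
by apply: measurable_maxr => //; apply: measurable_funB => //; exact: measurable_mdist.
Qed.

Let maX : measurable_fun setT (fun x => alpha (X x)).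
Proof. exact: measurable_rate. Qed.

Let mS y : measurable [set x | y < alpha (X x)].
Proof.
have := @measurable_fun_ltr _ _ _ setT (cst y) _ (@measurable_cst _ _ _ _ _ _) maX measurableT [set true].
by rewrite setTI; apply.
Qed.

(** Marton's argument. If [t > 0] is the level of [alpha] at height [y], then
    [d(., x0) >= B + t] on the set [S]; conditioning on [S] thus moves the mean of
    [d(., x0)] by at least [t] and has entropy [- ln (mu S)]. *)
Lemma transport_tail (y : R) : 0 <= y ->
  (mu [set x | (y < alpha (X x))%R] <= (expR (- y))%:E)%E.
Proof.
move=> y0; set S := [set x | _].
have [t [t0 yt St]] := convex_rate_level alpha0 alpha_incr alpha_convex k0 lin y0.
have mSy : measurable S := mS y.
have muSfin : mu S \is a fin_num by apply: fin_num_measure; exact: mS.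
pose c := fine (mu S).
have muS : mu S = c%:E by rewrite fineK.
have [c0|c0] := leP c 0; first by rewrite muS lee_fin (le_trans c0)// expR_ge0.
have [t_eq0|t_neq0] := eqVneq t 0.
  have -> : y = 0 by move: yt; rewrite t_eq0 alpha0; lra.
  by rewrite oppr0 expR0; exact: probability_le1 (mS _).
have [nu [nuS Hnu]] := conditional_probability (mS y) c0 muS.
have Bfin : first_moment x0 mu \is a fin_num by rewrite muB.
have B0 : 0 <= B.
  rewrite -lee_fin -muB; apply: integral_ge0 => x _.
  by rewrite lee_fin mdist_ge0.
have BtS : ((B + t)%:E <= first_moment x0 nu)%E.
  have <- : (\int[nu]_x ((B + t) * \1_S x)%:E = (B + t)%:E)%E.
    have m1E : measurable_fun setT (fun x => (\1_S x : R)%:E).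
      by apply/measurable_EFinP; exact: measurable_indic (mS _).
    under eq_integral do rewrite EFinM.
    rewrite ge0_integralZl// ?lee_fin ?addr_ge0//.
    rewrite integral_indic//; transitivity ((B + t)%:E * nu S)%E; first by rewrite setIT.
    by rewrite nuS mule1.
  apply: ge0_le_integral => //.
  - by move=> x _; rewrite lee_fin mulr_ge0// addr_ge0.
  - by apply/measurable_EFinP; exact: measurable_funM.
  - by apply/measurable_EFinP; exact: measurable_mdist.
  - move=> x _; rewrite lee_fin indicE; case: (boolP (x \in S)) => xS.
      rewrite mulr1; have := St (X x); move: xS; rewrite inE /S/= => yx /(_ yx (X0 x)).
      by rewrite /X le_max => /orP[|]; lra.
    by rewrite mulr0 mdist_ge0.
have := le_trans BtS (first_moment_le_transport_cost nu sepE Bfin).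
rewrite muB addeC EFinD leeD2lE// => tcost.
have := le_trans (extend_ge alpha_incr t0 tcost) (mu_T1 nu).
rewrite Hnu lee_fin => h; rewrite muS lee_fin -[leLHS]lnK ?posrE// ler_expR.
lra.
Qed.

(** Decompose according to the integer [n] with [n < alpha X <= n + 1]. The level
    [n] contributes at most [expR (delta * (n + 1)) * expR (- n)], a geometric
    series of ratio [expR (delta - 1)], whose distance to 1 is at least
    [(1 - delta) / 2]. *)
Lemma transport_exp_moment (delta : R) : 0 < delta < 1 ->
  (\int[mu]_x (expR (delta * alpha (X x)))%:E <=
   ((1 + 2 * expR 1) / (1 - delta))%:E)%E.
Proof.
move=> /andP[d0 d1].
pose S (n : nat) := [set x : borel E | n%:R < alpha (X x)].
(* For [alpha X > 0] the term [f n], where [n < alpha X <= n + 1], already bounds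
   the integrand; the summand 1 below covers the points where [alpha X = 0]. *)
pose f (n : nat) (x : borel E) : \bar R := (expR (delta * n.+1%:R) * \1_(S n) x)%:E.
have f0 n x : (0 <= f n x)%E by rewrite lee_fin mulr_ge0// expR_ge0.
have mf n : measurable_fun setT (f n).
  by apply/measurable_EFinP; apply: measurable_funM => //; exact: measurable_indic (mS _).
have mg : measurable_fun setT (fun x => (expR (delta * alpha (X x)))%:E).
  apply/measurable_EFinP; apply: measurableT_comp; first exact: measurable_expR.
  exact: measurable_funM.
have msum : measurable_fun setT (fun x => \sum_(n <oo) f n x)%E.
  exact: ge0_emeasurable_sum.
have sum0 x : (0 <= \sum_(n <oo) f n x)%E by exact: nneseries_ge0.
have g0 x : (0 <= (expR (delta * alpha (X x)))%:E)%E by rewrite lee_fin expR_ge0.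
apply: (@le_trans _ _ (\int[mu]_x (1 + \sum_(n <oo) f n x))%E).
  apply: ge0_le_integral => //.
  - exact: emeasurable_funD.
  - move=> x _; have := alpha_ge0 (X0 x); rewrite le_eqVlt => /predU1P[<-|aX0].
      by rewrite mulr0 expR0 leeDl.
    have [n /andP[nX Xn]] : exists n : nat, n%:R < alpha (X x) <= n.+1%:R.
      have ex : exists n : nat, alpha (X x) <= n%:R.
        by exists (Num.bound (alpha (X x))); rewrite ltW// archi_boundP// ltW.
      case: (ex_minnP ex) => -[|n] hn min_n; first by move: hn; lra.
      exists n; rewrite hn andbT ltNge; apply/negP => /min_n.
      by rewrite ltnn.
    apply: (@le_trans _ _ (f n x)).
      by rewrite lee_fin indicE mem_set// mulr1 ler_expR ler_pM2l.
    apply: (@le_trans _ _ (\sum_(n <oo) f n x)%E); last by rewrite leeDr.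
    apply: le_trans (nneseries_lim_ge n.+1 _) => //.
    by rewrite big_nat_recr//= leeDr// sume_ge0.
rewrite ge0_integralD// integral_nneseries//.
pose r := expR (delta - 1).
have r_lt1 : 1 - r >= (1 - delta) / 2.
  have : r <= (2 - delta)^-1.
    rewrite /r -[delta - 1]opprK expRN lef_pV2 ?posrE ?expR_gt0//; last by lra.
    have := expR_ge1Dx (- (delta - 1)); lra.
  have : (2 - delta)^-1 <= 1 - (1 - delta) / 2.
    rewrite -div1r ler_pdivrMr; last by lra.
    nra.
  lra.
have r1 : 0 < 1 - r by lra.
have sum_le : (\sum_(n <oo) \int[mu]_x f n x <= (expR 1 * (2 / (1 - delta)))%:E)%E.
  apply: lime_le.
    by apply: is_cvg_nneseries => n _ _; exact: integral_ge0.
  apply: nearW => n.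
  have fle (i : nat) : (\int[mu]_x f i x <= (expR 1 * r ^+ i)%:E)%E.
    have mSi : measurable (S i) by exact: mS.
    have m1E : measurable_fun setT (fun x => (\1_(S i) x : R)%:E).
      by apply/measurable_EFinP; exact: measurable_indic mSi.
    rewrite /f; under eq_integral do rewrite EFinM.
    rewrite ge0_integralZl// ?lee_fin ?expR_ge0// integral_indic//.
    apply: (@le_trans _ _ ((expR (delta * i.+1%:R))%:E * (expR (- i%:R))%:E)%E).
      rewrite lee_wpmul2l ?lee_fin ?expR_ge0// setIT.
      by apply: transport_tail.
    rewrite -EFinM lee_fin -expRD -expRM_natr -expRD ler_expR.
    rewrite -[i.+1%:R]natr1; lra.
  apply: (@le_trans _ _ (\sum_(0 <= i < n) (expR 1 * r ^+ i)%:E)%E).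
    by apply: lee_sum => i _; exact: fle.
  rewrite sumEFin lee_fin -big_distrr/= ler_wpM2l ?expR_ge0//.
  rewrite -(ler_pM2l r1) big_mkord.
  have -> : (1 - r) * \sum_(i < n) r ^+ i = 1 - r ^+ n.
    by apply: oppr_inj; rewrite -mulNr opprB opprB -subrX1.
  have : 0 <= r ^+ n by rewrite exprn_ge0// expR_ge0.
  have : 1 <= (1 - r) * (2 / (1 - delta)).
    by rewrite mulrA ler_pdivlMr ?mul1r; lra.
  lra.
apply: le_trans (leeD2l _ sum_le) _.
have -> : (\int[mu]_x 1 = 1)%E.
  by rewrite integral_cst// mul1e; exact: probability_setT.
rewrite -EFinD lee_fin mulrA -lerBrDr -mulrBl.
rewrite ler_pdivlMr; last by lra.
have : 0 <= expR 1 :> R by exact: expR_ge0.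
lra.
Qed.

End transport_tail.

(** * The transport inequality from an exponential moment *)

(** The simple functions below [f] are below [g]. This form allows comparison with
    functions not known to be measurable, such as those of a varying first
    moment. *)
Lemma le_nonneg_integral d (T : measurableType d) (R : realType)
    (mu : {measure set T -> \bar R}) (f g : T -> \bar R) :
  (forall x, 0 <= f x)%E -> (forall x, f x <= g x)%E ->
  (\int[mu]_x f x <= \int[mu]_x g x)%E.
Proof.
move=> f0 fg; have g0 x : (0 <= g x)%E by exact: le_trans (fg x).
rewrite !ge0_integralTE//; apply: ereal_sup_le => _ [h hf <-].
by exists h => // x; exact: le_trans (fg x).
Qed.

(** Convexity of the exponential between 0 and [z]. *)
Lemma expR_interpolation (R : realType) (q z : R) : 0 <= q <= 1 ->
  expR (q * z) <= 1 - q + q * expR z.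
Proof.
move=> /andP[q0 q1].
have h1 : expR (q * z) * (1 + (1 - q) * z) <= expR z.
  have -> : expR z = expR (q * z) * expR ((1 - q) * z) by rewrite -expRD; congr expR; ring.
  by rewrite ler_wpM2l ?expR_ge0// expR_ge1Dx.
have h2 : expR (q * z) * (1 - q * z) <= 1.
  rewrite -[leRHS](expRxMexpNx_1 (q * z)) ler_wpM2l ?expR_ge0//.
  exact: expR_ge1Dx.
have : q * (expR (q * z) * (1 + (1 - q) * z)) <= q * expR z by rewrite ler_wpM2l.
have : (1 - q) * (expR (q * z) * (1 - q * z)) <= (1 - q) * 1.
  by rewrite ler_wpM2l// subr_ge0.
lra.
Qed.

Section exp_moment_transport.
Context {R : realType} (alpha : R -> R).
Hypotheses (alpha0 : alpha 0 = 0)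
  (alpha_ge0 : forall t : R, 0 <= t -> 0 <= alpha t)
  (alpha_incr : forall s t : R, 0 <= s -> s <= t -> alpha s <= alpha t)
  (alpha_convex : @convex_function R R^o `[0, +oo[%classic alpha).

Let measurable_expR_rate d (T : measurableType d) (f : T -> R) :
  (forall x, 0 <= f x) -> measurable_fun setT f ->
  measurable_fun setT (fun x => (expR (alpha (f x)))%:E).
Proof.
move=> f0 mf; apply/measurable_EFinP; apply: measurableT_comp.
  exact: measurable_expR.
exact: measurable_rate.
Qed.

(** Jensen's inequality for the power [1 / p], in the pointwise form of
    [expR_interpolation] at [z = alpha (f x) - ln K]: it bounds the new moment by
    [expR (ln K / p)], which is at most 2. *)
Lemma exp_moment_rescale d (T : measurableType d) (mu : probability T R)
    (f : T -> R) (K p : R) :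
  (forall x, 0 <= f x) -> measurable_fun setT f ->
  0 < K -> 1 <= p -> ln K <= p * ln 2 ->
  (\int[mu]_x (expR (alpha (f x)))%:E <= K%:E)%E ->
  (\int[mu]_x (expR (alpha (f x / p)))%:E <= 2%:E)%E.
Proof.
move=> f0 mf K0 p1 Kp intK.
have p0 : 0 < p by lra.
have q01 : 0 <= p^-1 <= 1 by rewrite invr_ge0 (ltW p0)/= invf_le1.
have [q0 q1] := andP q01.
have E0 x : (0 <= (expR (alpha (f x)))%:E)%E by rewrite lee_fin expR_ge0.
have mE := measurable_expR_rate f0 mf.
apply: (@le_trans _ _
    (\int[mu]_x ((2 * (1 - p^-1))%:E + (2 * (p^-1 / K))%:E * (expR (alpha (f x)))%:E))%E).
  apply: le_nonneg_integral => x; first by rewrite lee_fin expR_ge0.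
  rewrite -EFinM -EFinD lee_fin.
  have h1 : alpha (f x / p) <= p^-1 * alpha (f x).
    by rewrite mulrC; apply: convex_rate_scale.
  have h2 := expR_interpolation (alpha (f x) - ln K) q01.
  have h3 : expR (alpha (f x / p)) <=
      expR (p^-1 * (alpha (f x) - ln K)) * expR (p^-1 * ln K).
    by rewrite -expRD ler_expR; lra.
  have h4 : expR (p^-1 * ln K) <= 2.
    rewrite -[leRHS]lnK ?posrE// ler_expR.
    by rewrite mulrC ler_pdivrMr// mulrC.
  apply: (le_trans h3); rewrite expRB lnK ?posrE// in h2.
  have h5 : 0 <= expR (p^-1 * (alpha (f x) - ln K)) by exact: expR_ge0.
  apply: (@le_trans _ _ (expR (p^-1 * (alpha (f x) - ln K)) * 2)).
    by rewrite ler_wpM2l.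
  rewrite (_ : 2 * (p^-1 / K) * expR (alpha (f x)) =
    2 * (p^-1 * (expR (alpha (f x)) / K))); last by ring.
  lra.
have c0 : 0 <= 2 * (1 - p^-1) by lra.
have c1 : 0 <= 2 * (p^-1 / K) by rewrite mulr_ge0// divr_ge0// ltW.
have mcE : measurable_fun setT (fun x => (2 * (p^-1 / K))%:E * (expR (alpha (f x)))%:E)%E.
  exact: measurable_funeM.
have cE0 x : (0 <= (2 * (p^-1 / K))%:E * (expR (alpha (f x)))%:E)%E.
  by rewrite mule_ge0// lee_fin.
rewrite ge0_integralD// ?lee_fin// ge0_integralZl_EFin//.
have -> : (\int[mu]_x (2 * (1 - p^-1))%:E = (2 * (1 - p^-1))%:E)%E.
  by rewrite integral_cst// -[RHS]mule1; congr (_ * _)%E; exact: probability_setT.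
apply: (@le_trans _ _ ((2 * (1 - p^-1))%:E + (2 * (p^-1 / K))%:E * K%:E)%E).
  by rewrite leeD2l// lee_wpmul2l// lee_fin.
rewrite -EFinM -EFinD lee_fin.
have -> : 2 * (p^-1 / K) * K = 2 * p^-1 by rewrite -mulrA divfK// gt_eqF.
lra.
Qed.

Variables (k A K s1 : R).
Hypotheses (k0 : 0 < k) (A0 : 0 <= A) (K0 : 0 < K) (s10 : 0 < s1)
  (lin : forall s : R, 0 <= s -> k * s <= alpha s + A)
  (quad : forall s : R, 0 <= s <= s1 -> alpha s <= K * s ^+ 2).

Let M := 8 * expR A.
Let C := rate_constant (k / 2) M K s1.

(** Integrates the two pointwise Young inequalities. In the quadratic one the weight
    is [k / 2 * chi], because [expR (k * chi)] is what linear growth of [alpha]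
    compares with [expR (alpha chi)]. That inequality at [r = 1] also shows that
    the variation is finite. *)
Lemma weighted_variation_entropy d (T : measurableType d) (mu nu : probability T R)
    (F chi : T -> R) (H : R) :
  (forall x, 0 <= F x) -> measurable_fun setT F ->
  (forall B, measurable B -> nu B = (\int[mu]_(x in B) (F x)%:E)%E) ->
  (\int[mu]_x (relent (F x))%:E = H%:E)%E ->
  (forall x, 0 <= chi x) -> measurable_fun setT chi ->
  (\int[mu]_x (expR (alpha (chi x)))%:E <= 2%:E)%E ->
  exists J : R, [/\ (\int[mu]_x (chi x * `|F x - 1|)%:E)%E = J%:E,
    0 <= J & alpha (J / C) <= H].
Proof.
move=> F0 mF nuF HE chi0 mchi exp2.
set JE := (\int[mu]_x _)%E.
have r0 x : (0 <= (relent (F x))%:E)%E by rewrite lee_fin relent_ge0.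
have FE0 x : (0 <= (F x)%:E)%E by rewrite lee_fin.
have e0 x : (0 <= (expR (alpha (chi x)))%:E)%E by rewrite lee_fin expR_ge0.
have J0 x : (0 <= (chi x * `|F x - 1|)%:E)%E by rewrite lee_fin mulr_ge0.
have mr : measurable_fun setT (fun x => (relent (F x))%:E).
  by apply/measurable_EFinP; exact: measurableT_comp (@measurable_relent R) mF.
have mFE : measurable_fun setT (fun x => (F x)%:E) by exact/measurable_EFinP.
have me := measurable_expR_rate chi0 mchi.
have mJ : measurable_fun setT (fun x => (chi x * `|F x - 1|)%:E).
  apply/measurable_EFinP; apply: measurable_funM => //.
  apply: measurableT_comp => //; exact: measurable_funB.
have cst_int c : (\int[mu]_x c%:E = c%:E)%E.
  by rewrite integral_cst// -[RHS]mule1; congr (_ * _)%E; exact: probability_setT.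
have Fint : (\int[mu]_x (F x)%:E = 1)%E by rewrite -nuF// probability_setT.
have small r : 0 <= r <= 1 ->
    ((r * (k / 2))%:E * JE <= (H + r ^+ 2 * M)%:E)%E.
  move=> /andP[r_ge0 r_le1].
  have c0 : 0 <= r ^+ 2 * (4 * expR A) by rewrite !mulr_ge0// expR_ge0.
  have rk0 : 0 <= r * (k / 2) by rewrite mulr_ge0// divr_ge0// ltW.
  rewrite -ge0_integralZl_EFin//.
  apply: (@le_trans _ _ (\int[mu]_x ((relent (F x))%:E +
      (r ^+ 2 * (4 * expR A))%:E * (expR (alpha (chi x)))%:E))%E).
    apply: le_nonneg_integral => x; first by rewrite mule_ge0// lee_fin.
    rewrite -!EFinM -EFinD lee_fin.
    have y0 : 0 <= k / 2 * chi x by rewrite mulr_ge0// divr_ge0// ltW.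
    have r01 : 0 <= r <= 1 by rewrite r_ge0.
    have := young_relent_quadratic (F0 x) y0 r01.
    have : r ^+ 2 * (4 * expR (2 * (k / 2 * chi x))) <=
           r ^+ 2 * (4 * expR A) * expR (alpha (chi x)).
      have -> : r ^+ 2 * (4 * expR A) * expR (alpha (chi x)) =
          r ^+ 2 * (4 * (expR A * expR (alpha (chi x)))) by ring.
      rewrite ler_wpM2l ?sqr_ge0// ler_wpM2l// -expRD ler_expR.
      by have := lin (chi0 x); lra.
    rewrite -!mulrA; lra.
  have mce : measurable_fun setT (fun x => (r ^+ 2 * (4 * expR A))%:E *
      (expR (alpha (chi x)))%:E)%E by exact: measurable_funeM.
  have ce0 x : (0 <= (r ^+ 2 * (4 * expR A))%:E * (expR (alpha (chi x)))%:E)%E.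
    by rewrite mule_ge0// lee_fin.
  rewrite ge0_integralD// HE ge0_integralZl_EFin// EFinD leeD2l//.
  apply: (@le_trans _ _ ((r ^+ 2 * (4 * expR A))%:E * 2%:E)%E).
    by rewrite lee_wpmul2l// lee_fin.
  by rewrite -EFinM lee_fin /M le_eqVlt; apply/orP; left; apply/eqP; ring.
have M2 : 2 <= M.
  by rewrite /M; have : 1 <= expR A; [rewrite -expR0 ler_expR|lra].
have k20 : 0 < k / 2 by rewrite divr_gt0.
have JE0 : (0 <= JE)%E by exact: integral_ge0.
have r11 : 0 <= (1 : R) <= 1 by lra.
have := small 1 r11; move: JE0 small.
case JEE: JE => [J| |]// JE0 small; last first.
  by rewrite mul1r gt0_muley ?lte_fin// leye_eq.
move=> _; exists J; split => //.
have Jr0 : 0 <= J by rewrite -lee_fin.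
apply: (rate_inequality alpha0 alpha_ge0 alpha_incr alpha_convex k20 M2 K0 s10 quad Jr0).
- by move=> r /small; rewrite -EFinM lee_fin mulrA.
- move=> t b t0 b0 tb.
  rewrite -(lerD2r 2) -lee_fin.
  apply: (@le_trans _ _ (\int[mu]_x (t%:E * (chi x * `|F x - 1|)%:E + 2%:E))%E).
    have mtJ : measurable_fun setT (fun x => t%:E * (chi x * `|F x - 1|)%:E)%E.
      exact: measurable_funeM.
    have tJ0 x : (0 <= t%:E * (chi x * `|F x - 1|)%:E)%E by rewrite mule_ge0// lee_fin.
    rewrite ge0_integralD// ge0_integralZl_EFin// cst_int.
    by rewrite -/JE JEE -EFinM -EFinD.
  have m2e : measurable_fun setT (fun x => 2%:E * (expR (alpha (chi x)))%:E)%E.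
    exact: measurable_funeM.
  have e20 x : (0 <= 2%:E * (expR (alpha (chi x)))%:E)%E by rewrite mule_ge0// lee_fin.
  have mbF : measurable_fun setT (fun x => b%:E * (F x)%:E + b%:E)%E.
    by apply: emeasurable_funD => //; exact: measurable_funeM.
  have bF0 x : (0 <= b%:E * (F x)%:E + b%:E)%E.
    by rewrite adde_ge0// ?mule_ge0// lee_fin.
  apply: (@le_trans _ _ (\int[mu]_x ((relent (F x))%:E +
     (2%:E * (expR (alpha (chi x)))%:E + (b%:E * (F x)%:E + b%:E))))%E).
    apply: le_nonneg_integral => x.
      by rewrite adde_ge0// ?mule_ge0// lee_fin.
    rewrite -!EFinM -!EFinD lee_fin.
    have tc0 : 0 <= t * chi x by rewrite mulr_ge0.
    have := young_relent_convex (F0 x) tc0 (tb _ (chi0 x)); lra.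
  have mbF' : measurable_fun setT (fun x => b%:E * (F x)%:E)%E.
    exact: measurable_funeM.
  have bF0' x : (0 <= b%:E * (F x)%:E)%E by rewrite mule_ge0// lee_fin.
  have msum : measurable_fun setT (fun x => 2%:E * (expR (alpha (chi x)))%:E +
      (b%:E * (F x)%:E + b%:E))%E by exact: emeasurable_funD.
  have sum0 x : (0 <= 2%:E * (expR (alpha (chi x)))%:E +
      (b%:E * (F x)%:E + b%:E))%E by rewrite adde_ge0.
  rewrite ge0_integralD// ge0_integralD// ge0_integralD//.
  rewrite !ge0_integralZl_EFin// HE Fint cst_int mule1.
  apply: (@le_trans _ _ (H%:E + (2%:E * 2%:E + (b%:E + b%:E)))%E).
    by rewrite leeD2l// leeD2r// lee_wpmul2l// lee_fin.
  by rewrite -EFinM -!EFinD lee_fin; lra.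
Qed.

Lemma T1_of_exp_moment (E : completeMetricType R) (mu : probability (borel E) R)
    (x0 : E) (s a : R) : separable E -> 0 < s -> C <= a * s ->
  (\int[mu]_x (expR (alpha (s * mdist (x : E) x0)))%:E <= 2%:E)%E ->
  T1 (fun t => alpha (t / a)) mu.
Proof.
move=> sepE s0 Ca exp2 nu.
have [numu|numu] := pselect (nu `<< mu); last first.
  by rewrite /relative_entropy asboolF// leey.
have [F [F0 mF nuF]] := exists_density numu.
rewrite (relative_entropy_density F0 mF nuF).
case HE : (\int[mu]_x (relent (F x))%:E)%E => [H| |]; last 2 first.
- by rewrite leey.
- have : (0 <= \int[mu]_x (relent (F x))%:E)%E.
    by apply: integral_ge0 => x _; rewrite lee_fin relent_ge0.
  by rewrite HE.
have M2 : 2 <= M.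
  by rewrite /M; have : 1 <= expR A; [rewrite -expR0 ler_expR|lra].
have k20 : 0 < k / 2 by rewrite divr_gt0.
have C0 : 0 < C := rate_constant_gt0 k20 M2 K0 s10.
have a0 : 0 < a by rewrite -(pmulr_lgt0 _ s0); exact: lt_le_trans Ca.
have md0 x : 0 <= s * mdist x x0 by rewrite mulr_ge0 ?mdist_ge0// ltW.
have mmd : measurable_fun setT (fun x : borel E => s * mdist (x : E) x0).
  by apply: measurable_funM => //; exact: measurable_mdist.
have [J [JE J0 HJ]] := weighted_variation_entropy F0 mF nuF HE md0 mmd exp2.
have cost_le : (transport_cost mu nu <= (J / s)%:E)%E.
  apply: le_trans (transport_cost_le_weighted_variation F0 mF nuF x0 sepE) _.
  have mJ : measurable_fun setT
      (fun x : borel E => (s * mdist (x : E) x0 * `|F x - 1|)%:E).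
    apply/measurable_EFinP; apply: measurable_funM => //.
    by apply: measurableT_comp => //; exact: measurable_funB.
  have J0' (x : borel E) : (0 <= (s * mdist (x : E) x0 * `|F x - 1|)%:E)%E.
    by rewrite lee_fin mulr_ge0.
  rewrite EFinM -JE muleC -ge0_integralZl_EFin ?invr_ge0 ?(ltW s0)//.
  rewrite le_eqVlt; apply/orP; left; apply/eqP; apply: eq_integral => x _.
  by rewrite -EFinM; congr EFin; field; apply: lt0r_neq0.
have cost_ge0 : (0 <= transport_cost mu nu)%E.
  apply: le_ereal_inf_tmp => _ [pi _ <-]; apply: integral_ge0 => z _.
  by rewrite lee_fin mdist_ge0.
case: (transport_cost mu nu) cost_le cost_ge0 => [c| |]//.
rewrite !lee_fin => cJ c0; apply: le_trans HJ.
apply: alpha_incr; first by rewrite divr_ge0// ltW.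
rewrite ler_pdivrMr//; apply: le_trans cJ _.
rewrite ler_pdivrMr// -mulrA -mulrA ler_peMr//.
by rewrite mulrC ler_pdivlMr// mul1r.
Qed.

End exp_moment_transport.

(** * Exponential moments of the members of the family *)

Section mixture_exp_moment.
Context {R : realType} (alpha : R -> R).
Hypotheses (alpha0 : alpha 0 = 0)
  (alpha_ge0 : forall t : R, 0 <= t -> 0 <= alpha t)
  (alpha_incr : forall s t : R, 0 <= s -> s <= t -> alpha s <= alpha t)
  (alpha_convex : @convex_function R R^o `[0, +oo[%classic alpha).
Variables (k A : R).
Hypotheses (k0 : 0 < k) (lin : forall s : R, 0 <= s -> k * s <= alpha s + A).

(** Linear growth makes [alpha] unbounded. *)
Lemma extend_pinfty : extend alpha +oo = +oo%E.
Proof.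
apply/eqP; rewrite -leye_eq leNgt; apply/negP => supy.
have := extend_ge alpha_incr (lexx 0) (leey 0%:E); rewrite alpha0 => sup0.
move: supy sup0; case E : (extend alpha +oo) => [r| |]// _; rewrite lee_fin => r0.
pose s := Num.max ((r + A + 1) / k) 0.
have s0 : 0 <= s by rewrite le_max lexx orbT.
have : ((alpha s)%:E <= r%:E)%E by rewrite -E; exact: extend_ge (leey _).
rewrite lee_fin => sr.
have : r + A + 1 <= k * s by rewrite mulrC -ler_pdivrMr// le_max lexx.
have := lin s0; lra.
Qed.

(** Bounds [d(., x0)] by [B + X] and uses convexity with the weights
    [delta * lambda], [delta] and the remainder on 0. If the first moment is
    infinite, so is the right-hand side. *)
Lemma T1_exp_moment (E : completeMetricType R) (mu : probability (borel E) R)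
    (x0 : E) (lambda delta : R) : separable E -> T1 alpha mu ->
  0 < lambda -> 0 < delta -> delta < (lambda + 1)^-1 ->
  (\int[mu]_x (expR (alpha (delta * mdist (x : E) x0)))%:E <=
   ((1 + 2 * expR 1) / (1 - delta))%:E *
   expeR ((delta * lambda)%:E *
     extend alpha (first_moment x0 mu * (lambda^-1)%:E)))%E.
Proof.
move=> sepE muT1 l0 d0 dl.
have dl1 : delta * lambda + delta <= 1.
  rewrite -[X in _ + X]mulr1 -mulrDr -ler_pdivlMr; last by lra.
  by rewrite div1r ltW.
have d1 : delta < 1 by have := mulr_gt0 d0 l0; lra.
have L0 : 0 < (1 + 2 * expR 1) / (1 - delta).
  by rewrite divr_gt0//; have : 0 < expR 1 :> R by [exact: expR_gt0|]; lra.
have B0 : (0 <= first_moment x0 mu)%E.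
  by apply: integral_ge0 => x _; rewrite lee_fin mdist_ge0.
case BE : (first_moment x0 mu) B0 => [B| |]// B0; last first.
  rewrite gt0_mulye ?lte_fin ?invr_gt0// extend_pinfty.
  by rewrite gt0_muley ?lte_fin ?mulr_gt0//= gt0_muley ?lte_fin// leey.
rewrite lee_fin in B0.
have d01 : 0 < delta < 1 by rewrite d0.
have tail := transport_exp_moment alpha0 alpha_ge0 alpha_incr alpha_convex k0 lin sepE muT1 BE d01.
pose e := expR (delta * lambda * alpha (B / lambda)).
have -> : expeR ((delta * lambda)%:E * extend alpha (B%:E * (lambda^-1)%:E))%E = e%:E.
  by [].
pose X (x : borel E) : R := Num.max (mdist (x : E) x0 - B) 0.
have X0 x : 0 <= X x by rewrite /X le_max lexx orbT.
apply: (@le_trans _ _ (\int[mu]_x (e%:E * (expR (delta * alpha (X x)))%:E))%E).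
  apply: le_nonneg_integral => x; first by rewrite lee_fin expR_ge0.
  rewrite -EFinM lee_fin /e -expRD ler_expR.
  have Bl0 : 0 <= B * lambda^-1 by rewrite divr_ge0// ltW.
  have dl0 : 0 <= delta * lambda by rewrite mulr_ge0// ltW.
  have := convex_rate_comb alpha0 alpha_convex dl0 (ltW d0) dl1 Bl0 (X0 x).
  apply: le_trans; apply: alpha_incr; first by rewrite mulr_ge0 ?mdist_ge0// ltW.
  have -> : delta * lambda * (B * lambda^-1) = delta * B.
    by field; exact: lt0r_neq0.
  rewrite -mulrDr ler_wpM2l ?(ltW d0)// -lerBlDl /X le_max lexx//.
have mX : measurable_fun setT X.
  by apply: measurable_maxr => //; apply: measurable_funB => //; exact: measurable_mdist.
have g0 x : (0 <= (expR (delta * alpha (X x)))%:E)%E by rewrite lee_fin expR_ge0.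
have mg : measurable_fun setT (fun x => (expR (delta * alpha (X x)))%:E).
  apply/measurable_EFinP; apply: measurableT_comp; first exact: measurable_expR.
  by apply: measurable_funM => //; exact: (measurable_rate alpha_incr).
by rewrite ge0_integralZl_EFin ?expR_ge0// muleC lee_wpmul2r// lee_fin expR_ge0.
Qed.

End mixture_exp_moment.

(** * The mixture *)

Unset Implicit Arguments.

Theorem theorem2p17 (R : realType) (alpha : R -> R)
  (alpha0 : alpha 0 = 0)
  (alpha_ge0 : forall t : R, 0 <= t -> 0 <= alpha t)
  (alpha_incr : forall s t : R, 0 <= s -> s <= t -> alpha s <= alpha t)
  (alpha_convex : @convex_function R R^o `[0, +oo[%classic alpha)
  (alpha_dom : exists2 b0 : \bar R, (0 < b0)%E &
     [set t : R | 0 <= t /\ (conjugate alpha t < +oo)%E] =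
     [set t : R | 0 <= t /\ (t%:E < b0)%E])
  (alpha_quad : exists t0 c0 : R, [/\ 0 < t0, 0 < c0 &
     forall t : R, 0 <= t <= t0 -> ((c0 * t ^+ 2)%:E <= conjugate alpha t)%E]) :
  exists2 m_alpha : R, 0 < m_alpha &
  forall (E : completeMetricType R) (sepE : separable E)
    (disp : measure_display) (Theta : measurableType disp)
    (m : probability Theta R)
    (mu : Theta -> probability (borel E) R)
    (mmu : measurable_family mu)
    (mu_T1 : forall theta, T1 alpha (mu theta))
    (x0 : E) (lambda delta : R)
    (lambda_gt0 : 0 < lambda) (delta_gt0 : 0 < delta)
    (delta_lt : delta < (lambda + 1)^-1),
  let I : \bar R := (\int[m]_theta expeR ((delta * lambda)%:E *
             extend alpha (first_moment x0 (mu theta) * (lambda^-1)%:E)))%E in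
  (I < +oo)%E ->
  let a : R := 2 * Num.sqrt 2 * m_alpha / delta *
    (1 + 1 / ln 2 * ln ((1 + delta) / (1 - delta) * fine I)) in
  T1 (fun t => alpha (t / a)) (mixture m mmu).
Proof.
have [b0 b0_gt0 domE] := alpha_dom.
have [k [A [k0 A0 lin]]] := conjugate_finite_linear b0_gt0 domE.
have [t0 [c0 [t0_gt0 c0_gt0 hquad]]] := alpha_quad.
have quad := conjugate_quadratic_upper alpha0 alpha_ge0 alpha_convex t0_gt0 c0_gt0 hquad.
have K0 : 0 < 2 / c0 by rewrite divr_gt0.
have s10 : 0 < c0 * t0 / 2 by rewrite divr_gt0// mulr_gt0.
pose C := rate_constant (k / 2) (8 * expR A) (2 / c0) (c0 * t0 / 2).
have C0 : 0 < C.
  apply: rate_constant_gt0 => //; first by rewrite divr_gt0.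
  by have : 1 <= expR A; [rewrite -expR0 ler_expR|lra].
pose L : R := 1 + 2 * expR 1.
have L1 : 1 <= L by rewrite /L lerDl mulr_ge0// expR_ge0.
have L0 : 0 < L by lra.
have ln2 : 0 < ln 2 :> R by rewrite ln_gt0// ltr1n.
have lnL : 0 <= ln L / ln 2 by apply: divr_ge0; [exact: ln_ge0|exact: ltW].
(* [L] is the constant of [transport_exp_moment]. *)
exists (C * (1 + ln L / ln 2)); first by rewrite mulr_gt0//; lra.
move=> E sepE disp Theta m mu mmu mu_T1 x0 lambda delta lambda_gt0 delta_gt0 delta_lt.
move=> I Ify a.
have dl1 : delta * lambda + delta < 1.
  rewrite -[X in _ + X]mulr1 -mulrDr -ltr_pdivlMr; last by lra.
  by rewrite div1r.
have d1 : delta < 1 by have := mulr_gt0 delta_gt0 lambda_gt0; lra.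
have I1 : (1 <= I)%E.
  have <- : (\int[m]_theta 1 = 1)%E.
    by rewrite integral_cst// mul1e; exact: probability_setT.
  apply: le_nonneg_integral => // theta.
  rewrite -expeR0 lee_expeR mule_ge0 ?lee_fin ?mulr_ge0 ?(ltW delta_gt0) ?(ltW lambda_gt0)//.
  have := @extend_ge R alpha 0 (first_moment x0 (mu theta) * (lambda^-1)%:E)%E
    alpha_incr (lexx 0).
  rewrite alpha0; apply; apply: mule_ge0; last by rewrite lee_fin invr_ge0 ltW.
  by apply: integral_ge0 => x _; rewrite lee_fin mdist_ge0.
have IE : I = (fine I)%:E.
  by rewrite fineK// ge0_fin_numE//; exact: le_trans I1.
have I1' : 1 <= fine I by rewrite -lee_fin -IE.
pose Q := (1 + delta) / (1 - delta) * fine I.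
have Q1 : 1 <= Q.
  have : 1 <= (1 + delta) / (1 - delta) by rewrite ler_pdivlMr ?mul1r; lra.
  by move=> h; rewrite /Q -[leLHS]mulr1 ler_pM.
have lnQ : 0 <= ln Q / ln 2 by apply: divr_ge0; [exact: ln_ge0|exact: ltW].
pose p := (1 + ln L / ln 2) * (1 + ln Q / ln 2).
have p1 : 1 <= p by rewrite /p -[leLHS]mulr1 ler_pM//; lra.
have p0 : 0 < p by lra.
have md0 (x : borel E) : 0 <= delta * mdist (x : E) x0 by rewrite mulr_ge0 ?mdist_ge0// ltW.
have mmd : measurable_fun setT (fun x : borel E => delta * mdist (x : E) x0).
  by apply: measurable_funM => //; exact: measurable_mdist.
have exp_mix : (\int[mixture m mmu]_x (expR (alpha (delta * mdist (x : E) x0)))%:E <=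
    (L * Q)%:E)%E.
  have E0 (x : borel E) : (0 <= (expR (alpha (delta * mdist (x : E) x0)))%:E)%E.
    by rewrite lee_fin expR_ge0.
  have mE : measurable_fun setT
      (fun x : borel E => (expR (alpha (delta * mdist (x : E) x0)))%:E).
    apply/measurable_EFinP; apply: measurableT_comp; first exact: measurable_expR.
    exact: (measurable_rate alpha_incr).
  rewrite integral_mixture//.
  pose r := L / (1 - delta).
  have r0 : 0 < r by rewrite divr_gt0//; lra.
  have key : (\int[m]_theta (r^-1%:E * \int[mu theta]_x
      (expR (alpha (delta * mdist (x : E) x0)))%:E) <= I)%E.
    apply: le_nonneg_integral => theta.
      by rewrite mule_ge0 ?lee_fin ?invr_ge0 ?(ltW r0)// integral_ge0.
    rewrite lee_pdivrMl//.
    exact: (T1_exp_moment alpha0 alpha_ge0 alpha_incr alpha_convex k0 lin x0 sepE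
      (mu_T1 theta) lambda_gt0 delta_gt0 delta_lt).
  have mI : measurable_fun setT (fun theta => \int[mu theta]_x
      (expR (alpha (delta * mdist (x : E) x0)))%:E)%E.
    exact: (measurable_fun_integral_kernel mmu).
  have I0 theta : (0 <= \int[mu theta]_x
      (expR (alpha (delta * mdist (x : E) x0)))%:E)%E by exact: integral_ge0.
  move: key; rewrite ge0_integralZl_EFin ?invr_ge0 ?(ltW r0)//.
  rewrite lee_pdivrMl// => /le_trans; apply.
  rewrite IE -EFinM lee_fin /r /Q mulrA ler_wpM2r//; first by lra.
  rewrite mulrA ler_wpM2r ?invr_ge0//; first by lra.
  by rewrite ler_peMr ?(ltW L0)//; lra.
have LQ0 : 0 < L * Q by rewrite mulr_gt0//; lra.
have lnLQ : ln (L * Q) <= p * ln 2.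
  rewrite lnM ?posrE//; last by lra.
  have -> : p * ln 2 = ln 2 + ln L + ln Q + (ln L / ln 2) * (ln Q / ln 2) * ln 2.
    by rewrite /p; field; exact: lt0r_neq0.
  have := mulr_ge0 (mulr_ge0 lnL lnQ) (ltW ln2); lra.
have exp2 := exp_moment_rescale alpha0 alpha_incr alpha_convex
  md0 mmd LQ0 p1 lnLQ exp_mix.
have s0 : 0 < delta / p by rewrite divr_gt0.
have Ca : C <= a * (delta / p).
  have -> : a * (delta / p) = 2 * Num.sqrt 2 * C.
    rewrite /a -/Q /p (_ : 1 / ln 2 * ln Q = ln Q / ln 2); last by rewrite mulrC mul1r.
    have cancel (q u v e : R) : 0 < u -> 0 < v -> 0 < e ->
        q * (C * u) / e * v * (e / (u * v)) = q * C.
      by move=> u0 v0 e0; field; rewrite !gt_eqF.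
    by apply: cancel => //; lra.
  have : 1 <= Num.sqrt 2 :> R by rewrite -[leLHS]sqrtr1 ler_wsqrtr// ler1n.
  move=> sq; rewrite ler_peMl ?(ltW C0)//; lra.
apply: (T1_of_exp_moment alpha0 alpha_ge0 alpha_incr alpha_convex k0 A0 K0 s10
  lin quad sepE s0 Ca (x0 := x0)).
under eq_integral do rewrite mulrAC.
exact: exp2.
Qed.
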